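(* Let $\mathcal E$ be a Krull–Schmidt exact category which is $\operatorname{Hom}$-finite over a field $k$, and let $\mathcal A,\mathcal B,\mathcal C$ be full subcategories of $\mathcal E$. Suppose that: - $(\mathcal A,\mathcal B)$ and $(\mathcal B,\mathcal C)$ are torsion pairs in $\mathcal E$; - $\mathcal E$ has enough projective objects, which belong to $\mathcal C$; - there exists a projective object $P$ in $\mathcal E$ which is injective in $\mathcal C$ and satisfies $\mathcal A=\operatorname{add}P$; - $\mathcal B$ is an abelian category whose exact structure is compatible with that of $\mathcal E$. Then there is an equivalence of exact categories $\mathcal C/[\mathcal A]\xrightarrow{\sim}\operatorname{Sub}U$, where $U$ is an (explicitly constructed) injective object of $\mathcal B$.
   Context: $\operatorname{Hom}$-finite over $k$ means that $\mathcal E$ is $k$-linear with finite-dimensional morphism spaces. A torsion pair $(\mathcal X,\mathcal Y)$ in $\mathcal E$ is a pair of full subcategories with $\operatorname{Hom}_{\mathcal E}(\mathcal X,\mathcal Y)=0$ such that every $E\in\mathcal E$ has a short exact sequence $0\to X\to E\to Y\to0$ with $X\in\mathcal X$, $Y\in\mathcal Y$. $\operatorname{add}P$ is the full subcategory of direct summands of finite direct sums of copies of $P$. ''Injective in $\mathcal C$'' means $P\in\mathcal C$ and $\operatorname{Ext}^1_{\mathcal E}(\mathcal C,P)=0$. Compatibility of $\mathcal B$ means that the short exact sequences of the abelian category $\mathcal B$ are exactly the short exact sequences of $\mathcal E$ with all terms in $\mathcal B$. $\mathcal C/[\mathcal A]$ is the quotient of $\mathcal C$ by the ideal of morphisms factoring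 through objects of $\mathcal A$, with exact structure the pairs of morphisms isomorphic to images of short exact sequences of $\mathcal C$. $\operatorname{Sub}U$ is the smallest full subcategory containing $U$ and closed under finite direct sums and admissible subobjects. An equivalence of exact categories is an equivalence that is exact and induces isomorphisms on $\operatorname{Ext}^1$. In the explicit construction, $U$ is the object $U^P$ in a short exact sequence $0\to P\to C^P\to U^P\to0$ with $C^P\in\mathcal C$, $U^P\in\mathcal B$ and $\operatorname{Ext}^1_{\mathcal E}(\mathcal B,C^P)=0$; the functor is induced by the left adjoint $\mathcal E\to\mathcal B$ of the inclusion $\mathcal B\to\mathcal E$.
   Formalization: The existence of the short exact sequence 0→P→C^P→U^P→0 (C^P in C, U^P in B, Ext^1(B,C^P)=0) defining U is assumed; it does not follow from the listed hypotheses, and without it the claim fails, e.g. for finite-dimensional representations of the quiver …→2→1→0 with P simple at 0. *)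

(* Defs.v *)
(* Plain MathComp; mathcomp.classical.boolp is used only to quotient a vector
   space by a Prop-valued subspace. *)
From HB Require Import structures.
From mathcomp Require Import all_boot all_order all_algebra.
From mathcomp Require Import boolp.

Set Implicit Arguments.
Unset Strict Implicit.
Unset Printing Implicit Defensive.

Import GRing.Theory.
Local Open Scope ring_scope.
Local Open Scope quotient_scope.

Local Obligation Tactic := idtac.

(** * Quotient of a module by a submodule *)

Section LmodQuotient.
Variables (k : fieldType) (V : lmodType k).

Definition is_submod (S : V -> Prop) : Prop :=
  S 0 /\ forall (a : k) (u v : V), S u -> S v -> S (a *: u + v).

Variables (S : V -> Prop) (hS : is_submod S).

Definition lquot_rel (u v : V) : bool := `[< S (u - v) >].

Lemma lquot_rel_equiv : equiv_class_of lquot_rel.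
Proof.
have [S0 Slin] := hS; split=> [u|u v|v u w].
- by apply/asboolP; rewrite subrr.
- apply/asbool_equiv_eq; split=> Suv;
    by have := Slin (-1) _ _ Suv S0; rewrite addr0 scaleN1r opprB.
- move=> /asboolP Suv /asboolP Svw; apply/asboolP.
  by have := Slin 1 _ _ Suv Svw; rewrite scale1r addrA subrK.
Qed.

Canonical lquot_equiv := EquivRelPack lquot_rel_equiv.

Definition lquot : Type := {eq_quot lquot_equiv}.

HB.instance Definition _ := Choice.on lquot.
HB.instance Definition _ := EqQuotient.on lquot.

Definition lquot_pi (v : V) : lquot := \pi_lquot v.

Lemma lquot_piE (u v : V) : lquot_pi u = lquot_pi v <-> S (u - v).
Proof.
by split=> [/eqquotP/asboolP//|Suv]; apply/eqquotP/asboolP.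
Qed.

Lemma lquot_reprK (x : lquot) : lquot_pi (repr x) = x.
Proof. exact: reprK. Qed.

Lemma lquot_repr (v : V) : S (repr (lquot_pi v) - v).
Proof. by apply/lquot_piE; rewrite lquot_reprK. Qed.

Definition lquot_add (x y : lquot) := lquot_pi (repr x + repr y).
Definition lquot_opp (x : lquot) := lquot_pi (- repr x).
Definition lquot_scale (a : k) (x : lquot) := lquot_pi (a *: repr x).

Lemma lquot_pi_add u v :
  lquot_add (lquot_pi u) (lquot_pi v) = lquot_pi (u + v).
Proof.
apply/lquot_piE; rewrite opprD addrACA -[X in X + _]scale1r.
by apply: (proj2 hS); apply: lquot_repr.
Qed.

Lemma lquot_pi_scale a u : lquot_scale a (lquot_pi u) = lquot_pi (a *: u).
Proof.
apply/lquot_piE; rewrite -scalerBr -[X in S X]addr0.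
by apply: (proj2 hS); [apply: lquot_repr | case: hS].
Qed.

Lemma lquot_pi_opp u : lquot_opp (lquot_pi u) = lquot_pi (- u).
Proof.
by have := lquot_pi_scale (-1) u; rewrite /lquot_scale !scaleN1r.
Qed.

Lemma lquot_addA : associative lquot_add.
Proof.
move=> x y z; rewrite -(lquot_reprK x) -(lquot_reprK y) -(lquot_reprK z).
by rewrite !lquot_pi_add addrA.
Qed.

Lemma lquot_addC : commutative lquot_add.
Proof. by move=> x y; rewrite /lquot_add addrC. Qed.

Lemma lquot_add0 : left_id (lquot_pi 0) lquot_add.
Proof. by move=> x; rewrite -(lquot_reprK x) lquot_pi_add add0r. Qed.

Lemma lquot_addN : left_inverse (lquot_pi 0) lquot_opp lquot_add.
Proof.
by move=> x; rewrite -(lquot_reprK x) lquot_pi_opp lquot_pi_add addNr.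
Qed.

HB.instance Definition _ :=
  GRing.isZmodule.Build lquot lquot_addA lquot_addC lquot_add0 lquot_addN.

Lemma lquot_piD u v : lquot_pi (u + v) = lquot_pi u + lquot_pi v.
Proof. by rewrite -lquot_pi_add. Qed.

Lemma lquot_scaleA a b (x : lquot) :
  lquot_scale a (lquot_scale b x) = lquot_scale (a * b) x.
Proof. by rewrite -(lquot_reprK x) !lquot_pi_scale scalerA. Qed.

Lemma lquot_scale1 : left_id 1 lquot_scale.
Proof. by move=> x; rewrite -(lquot_reprK x) lquot_pi_scale scale1r. Qed.

Lemma lquot_scaleDr : right_distributive lquot_scale +%R.
Proof.
move=> a x y; rewrite -(lquot_reprK x) -(lquot_reprK y) -lquot_piD.
by rewrite !lquot_pi_scale -lquot_piD scalerDr.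
Qed.

Lemma lquot_scaleDl (x : lquot) : {morph lquot_scale^~ x : a b / a + b}.
Proof.
by move=> a b; rewrite -(lquot_reprK x) !lquot_pi_scale -lquot_piD scalerDl.
Qed.

HB.instance Definition _ :=
  GRing.Zmodule_isLmodule.Build k lquot
    lquot_scaleA lquot_scale1 lquot_scaleDr lquot_scaleDl.

Lemma lquot_pi_linear : linear lquot_pi.
Proof. by move=> a u v; rewrite lquot_piD -lquot_pi_scale. Qed.

End LmodQuotient.

(** * Linear categories *)

Record linCat (k : fieldType) := LinCat {
  obj :> Type;
  mor : obj -> obj -> lmodType k;
  idm : forall X, mor X X;
  comp : forall X Y Z, mor Y Z -> mor X Y -> mor X Z;
  compA : forall W X Y Z (h : mor Y Z) (g : mor X Y) (f : mor W X),
    comp h (comp g f) = comp (comp h g) f;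
  comp1m : forall X Y (f : mor X Y), comp (idm Y) f = f;
  compm1 : forall X Y (f : mor X Y), comp f (idm X) = f;
  comp_linearl : forall X Y Z (f : mor X Y),
    linear (fun g : mor Y Z => comp g f);
  comp_linearr : forall X Y Z (g : mor Y Z),
    linear (fun f : mor X Y => comp g f)
}.

Arguments mor {k l} X Y.
Arguments idm {k l} X.
Arguments comp {k l X Y Z} g f.

Notation "g ∘ f" := (comp g f) (at level 40, left associativity).

Section LinCatTheory.
Variables (k : fieldType) (C : linCat k).

Lemma comp_sumr (X Y Z : C) (g : mor Y Z) n (f : 'I_n -> mor X Y) :
  g ∘ (\sum_i f i) = \sum_i g ∘ f i.
Proof.
pose l := GRing.isLinear.Build k (mor X Y) (mor X Z) *:%R _
            (@comp_linearr _ _ X Y Z g).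
pose G : {linear mor X Y -> mor X Z} := HB.pack (fun f0 => g ∘ f0) l.
exact: (linear_sum G).
Qed.

Lemma comp_suml (X Y Z : C) (f : mor X Y) n (g : 'I_n -> mor Y Z) :
  (\sum_i g i) ∘ f = \sum_i g i ∘ f.
Proof.
pose l := GRing.isLinear.Build k (mor Y Z) (mor X Z) *:%R _
            (@comp_linearl _ _ X Y Z f).
pose G : {linear mor Y Z -> mor X Z} := HB.pack (fun g0 => g0 ∘ f) l.
exact: (linear_sum G).
Qed.

Lemma compDl (X Y Z : C) (g g' : mor Y Z) (f : mor X Y) :
  (g + g') ∘ f = g ∘ f + g' ∘ f.
Proof. by have := comp_linearl f 1 g g'; rewrite !scale1r. Qed.

Lemma compDr (X Y Z : C) (g : mor Y Z) (f f' : mor X Y) :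
  g ∘ (f + f') = g ∘ f + g ∘ f'.
Proof. by have := comp_linearr g 1 f f'; rewrite !scale1r. Qed.

Lemma comp0m (X Y Z : C) (f : mor X Y) : (0 : mor Y Z) ∘ f = 0.
Proof. by apply: (addrI (0 ∘ f)); rewrite -compDl !addr0. Qed.

Lemma compm0 (X Y Z : C) (g : mor Y Z) : g ∘ (0 : mor X Y) = 0.
Proof. by apply: (addrI (g ∘ 0)); rewrite -compDr !addr0. Qed.

Lemma compZl (X Y Z : C) a (g : mor Y Z) (f : mor X Y) :
  (a *: g) ∘ f = a *: (g ∘ f).
Proof. by have := comp_linearl f a g 0; rewrite comp0m !addr0. Qed.

Lemma compZr (X Y Z : C) a (g : mor Y Z) (f : mor X Y) :
  g ∘ (a *: f) = a *: (g ∘ f).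
Proof. by have := comp_linearr g a f 0; rewrite compm0 !addr0. Qed.

Lemma compBl (X Y Z : C) (g g' : mor Y Z) (f : mor X Y) :
  (g - g') ∘ f = g ∘ f - g' ∘ f.
Proof. by rewrite compDl -scaleN1r compZl scaleN1r. Qed.

Lemma compBr (X Y Z : C) (g : mor Y Z) (f f' : mor X Y) :
  g ∘ (f - f') = g ∘ f - g ∘ f'.
Proof. by rewrite compDr -scaleN1r compZr scaleN1r. Qed.

Definition is_iso (X Y : C) (f : mor X Y) : Prop :=
  exists g : mor Y X, g ∘ f = idm X /\ f ∘ g = idm Y.

Definition is_mono (X Y : C) (f : mor X Y) : Prop :=
  forall W (g g' : mor W X), f ∘ g = f ∘ g' -> g = g'.

Definition is_epi (X Y : C) (f : mor X Y) : Prop :=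
  forall Z (g g' : mor Y Z), g ∘ f = g' ∘ f -> g = g'.

Definition is_kernel (X Y Z : C) (i : mor X Y) (p : mor Y Z) : Prop :=
  p ∘ i = 0 /\
  forall W (f : mor W Y), p ∘ f = 0 -> exists! g : mor W X, i ∘ g = f.

Definition is_cokernel (X Y Z : C) (i : mor X Y) (p : mor Y Z) : Prop :=
  p ∘ i = 0 /\
  forall W (f : mor Y W), f ∘ i = 0 -> exists! g : mor Z W, g ∘ p = f.

Definition is_pushout (X Y X' Y' : C) (i : mor X Y) (f : mor X X')
    (i' : mor X' Y') (f' : mor Y Y') : Prop :=
  f' ∘ i = i' ∘ f /\
  forall W (u : mor Y W) (v : mor X' W), u ∘ i = v ∘ f ->
  exists! w : mor Y' W, w ∘ f' = u /\ w ∘ i' = v.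

Definition is_pullback (Y Z Y' Z' : C) (p : mor Y Z) (f : mor Z' Z)
    (p' : mor Y' Z') (f' : mor Y' Y) : Prop :=
  p ∘ f' = f ∘ p' /\
  forall W (u : mor W Y) (v : mor W Z'), p ∘ u = f ∘ v ->
  exists! w : mor W Y', f' ∘ w = u /\ p' ∘ w = v.

(* For n = 0 this says that W is a zero object. *)
Definition is_dirsum n (X : 'I_n -> C) (W : C) : Prop :=
  exists (s : forall i, mor (X i) W) (r : forall i, mor W (X i)),
    [/\ forall i, r i ∘ s i = idm (X i),
        forall i j, i != j -> r i ∘ s j = 0
      & \sum_i s i ∘ r i = idm W].

Definition is_biprod (X Y W : C) (s1 : mor X W) (s2 : mor Y W)
    (r1 : mor W X) (r2 : mor W Y) : Prop :=
  [/\ r1 ∘ s1 = idm X, r2 ∘ s2 = idm Y, r1 ∘ s2 = 0, r2 ∘ s1 = 0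
    & s1 ∘ r1 + s2 ∘ r2 = idm W].

Definition is_additive : Prop :=
  forall n (X : 'I_n -> C), exists W, is_dirsum X W.

Definition is_abelian : Prop :=
  [/\ is_additive,
      forall (Y Z : C) (p : mor Y Z), exists X (i : mor X Y), is_kernel i p,
      forall (X Y : C) (i : mor X Y), exists Z (p : mor Y Z), is_cokernel i p,
      forall (X Y : C) (i : mor X Y), is_mono i ->
        exists Z (p : mor Y Z), is_kernel i p
    & forall (Y Z : C) (p : mor Y Z), is_epi p ->
        exists X (i : mor X Y), is_cokernel i p].

Definition hom_finite : Prop :=
  forall X Y : C, exists n, inhabited (Vector.axiom n (mor X Y)).

(* End(X) is a local ring: it is nonzero and its non-units are closed under
   addition. *)
Definition has_local_end (X : C) : Prop :=
  idm X <> 0 /\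
  forall f g : mor X X, ~ is_iso f -> ~ is_iso g -> ~ is_iso (f + g).

Definition krull_schmidt : Prop :=
  forall X : C, exists n (Y : 'I_n -> C),
    (forall i, has_local_end (Y i)) /\ is_dirsum Y X.

Definition in_add (P X : C) : Prop :=
  exists n (W Y : C) (s1 : mor X W) (s2 : mor Y W) (r1 : mor W X)
    (r2 : mor W Y),
    is_dirsum (fun _ : 'I_n => P) W /\ is_biprod s1 s2 r1 r2.

End LinCatTheory.

(** * Linear functors *)

Record functor (k : fieldType) (C D : linCat k) := Functor {
  fobj :> C -> D;
  fmap : forall X Y : C, mor X Y -> mor (fobj X) (fobj Y);
  fmap_linear : forall X Y : C, linear (@fmap X Y);
  fmap1 : forall X, fmap (idm X) = idm (fobj X);
  fmapM : forall (X Y Z : C) (g : mor Y Z) (f : mor X Y),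
    fmap (g ∘ f) = fmap g ∘ fmap f
}.

Arguments fmap {k C D} f {X Y} m : rename.

Section Functors.
Variable k : fieldType.

Program Definition id_functor (C : linCat k) : functor C C :=
  @Functor k C C (fun X => X) (fun X Y f => f) _ _ _.
Next Obligation. by []. Qed.
Next Obligation. by []. Qed.
Next Obligation. by []. Qed.

Program Definition comp_functor (C D D' : linCat k)
    (G : functor D D') (F : functor C D) : functor C D' :=
  @Functor k C D' (fun X => G (F X)) (fun X Y f => fmap G (fmap F f)) _ _ _.
Next Obligation. by move=> C D D' G F X Y a u v; rewrite !fmap_linear. Qed.
Next Obligation. by move=> C D D' G F X /=; rewrite !fmap1. Qed.
Next Obligation. by move=> C D D' G F X Y Z g f /=; rewrite !fmapM. Qed.

Definition nat_isomorphic (C D : linCat k) (F G : functor C D) : Prop :=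
  exists t : forall X : C, mor (F X) (G X),
    (forall X, is_iso (t X)) /\
    (forall X Y (f : mor X Y), t Y ∘ fmap F f = fmap G f ∘ t X).

Definition is_equivalence (C D : linCat k) (F : functor C D) : Prop :=
  exists G : functor D C,
    nat_isomorphic (comp_functor G F) (id_functor C) /\
    nat_isomorphic (comp_functor F G) (id_functor D).

Definition is_left_adjoint (C D : linCat k) (L : functor C D)
    (R : functor D C) : Prop :=
  exists phi : forall (X : C) (Y : D), mor (L X) Y -> mor X (R Y),
    [/\ forall X Y, bijective (phi X Y),
        forall X' X Y (f : mor X' X) (g : mor (L X) Y),
          phi X' Y (g ∘ fmap L f) = phi X Y g ∘ f
      & forall X Y Y' (h : mor Y Y') (g : mor (L X) Y),
          phi X Y' (h ∘ g) = fmap R h ∘ phi X Y g].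

End Functors.

(** * Exact categories *)

(* A linear category with a class of distinguished composable pairs
   X -> Y -> Z, thought of as 0 -> X -> Y -> Z -> 0. *)
Record seqCat (k : fieldType) := SeqCat {
  seq_cat :> linCat k;
  ses : forall X Y Z : seq_cat, mor X Y -> mor Y Z -> Prop
}.

Arguments ses {k s X Y Z} i p.

Section Exact.
Variables (k : fieldType) (E : seqCat k).

Definition inflation (X Y : E) (i : mor X Y) : Prop :=
  exists Z (p : mor Y Z), ses i p.

Definition deflation (Y Z : E) (p : mor Y Z) : Prop :=
  exists X (i : mor X Y), ses i p.

(* Quillen's axioms, in Keller's and Buehler's form. *)
Record is_exact : Prop := IsExact {
  exact_additive : is_additive E;
  ses_kernel : forall (X Y Z : E) (i : mor X Y) (p : mor Y Z),
    ses i p -> is_kernel i p;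
  ses_cokernel : forall (X Y Z : E) (i : mor X Y) (p : mor Y Z),
    ses i p -> is_cokernel i p;
  ses_iso : forall (X Y Z X' Y' Z' : E) (i : mor X Y) (p : mor Y Z)
      (i' : mor X' Y') (p' : mor Y' Z')
      (a : mor X X') (b : mor Y Y') (c : mor Z Z'),
    is_iso a -> is_iso b -> is_iso c ->
    b ∘ i = i' ∘ a -> c ∘ p = p' ∘ b -> ses i p -> ses i' p';
  inflation1 : forall X : E, inflation (idm X);
  deflation1 : forall X : E, deflation (idm X);
  inflationM : forall (X Y Z : E) (f : mor X Y) (g : mor Y Z),
    inflation f -> inflation g -> inflation (g ∘ f);
  deflationM : forall (X Y Z : E) (f : mor X Y) (g : mor Y Z),
    deflation f -> deflation g -> deflation (g ∘ f);
  inflation_pushout : forall (X Y X' : E) (i : mor X Y) (f : mor X X'),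
    inflation i -> exists Y' (i' : mor X' Y') (f' : mor Y Y'),
      is_pushout i f i' f' /\ inflation i';
  deflation_pullback : forall (Y Z Z' : E) (p : mor Y Z) (f : mor Z' Z),
    deflation p -> exists Y' (p' : mor Y' Z') (f' : mor Y' Y),
      is_pullback p f p' f' /\ deflation p'
}.

Definition projective (P : E) : Prop :=
  forall (Y Z : E) (p : mor Y Z) (f : mor P Z),
    deflation p -> exists g : mor P Y, p ∘ g = f.

Definition enough_projectives : Prop :=
  forall X : E, exists Q (p : mor Q X), projective Q /\ deflation p.

Definition torsion_pair (T F : E -> Prop) : Prop :=
  (forall (X Y : E) (f : mor X Y), T X -> F Y -> f = 0) /\
  (forall W : E, exists (X Y : E) (i : mor X W) (p : mor W Y),
     [/\ T X, F Y & ses i p]).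

(** ** Yoneda extensions *)

Record extension (Z X : E) := Extension {
  ext_mid : E;
  ext_inf : mor X ext_mid;
  ext_def : mor ext_mid Z;
  ext_ses : ses ext_inf ext_def
}.

(* (a, b, c) is a morphism from e to e' for some middle component b. *)
Definition ext_morph (Z X Z' X' : E) (a : mor X X') (c : mor Z Z')
    (e : extension Z X) (e' : extension Z' X') : Prop :=
  exists b : mor (ext_mid e) (ext_mid e'),
    b ∘ ext_inf e = ext_inf e' ∘ a /\ ext_def e' ∘ b = c ∘ ext_def e.

(* Ext^1(Z, X) is the set of extensions of Z by X up to this relation. *)
Definition ext_equiv (Z X : E) (e e' : extension Z X) : Prop :=
  exists b : mor (ext_mid e) (ext_mid e'),
    [/\ is_iso b, b ∘ ext_inf e = ext_inf e' & ext_def e' ∘ b = ext_def e].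

(* The class of e is the zero element of Ext^1(Z, X). *)
Definition ext_split (Z X : E) (e : extension Z X) : Prop :=
  exists s : mor Z (ext_mid e), ext_def e ∘ s = idm Z.

(* The class of e' is a times the class of e. *)
Definition ext_scale (Z X : E) (a : k) (e e' : extension Z X) : Prop :=
  ext_morph (a *: idm X) (idm Z) e e'.

(* e12 is the direct sum of e1 and e2. *)
Definition ext_dirsum (Z1 X1 Z2 X2 Z X : E)
    (s1 : mor X1 X) (s2 : mor X2 X) (r1 : mor X X1) (r2 : mor X X2)
    (t1 : mor Z1 Z) (t2 : mor Z2 Z) (q1 : mor Z Z1) (q2 : mor Z Z2)
    (e1 : extension Z1 X1) (e2 : extension Z2 X2) (e12 : extension Z X)
  : Prop :=
  [/\ is_biprod s1 s2 r1 r2, is_biprod t1 t2 q1 q2,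
      ext_morph r1 q1 e12 e1 & ext_morph r2 q2 e12 e2].

(* The class of e is the Baer sum of the classes of e1 and e2: e is the
   pushout along the codiagonal r1 + r2 of the pullback e' along the diagonal
   t1 + t2 of the direct sum of e1 and e2. *)
Definition baer_sum (Z X : E) (e1 e2 e : extension Z X) : Prop :=
  exists (XX ZZ : E) (s1 s2 : mor X XX) (r1 r2 : mor XX X)
    (t1 t2 : mor Z ZZ) (q1 q2 : mor ZZ Z)
    (e12 : extension ZZ XX) (e' : extension Z XX),
    [/\ ext_dirsum s1 s2 r1 r2 t1 t2 q1 q2 e1 e2 e12,
        ext_morph (idm XX) (t1 + t2) e' e12
      & ext_morph (r1 + r2) (idm Z) e' e].

(* Ext^1(S, X) = 0. *)
Definition ext1_vanish (S : E -> Prop) (X : E) : Prop :=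
  forall Z, S Z -> forall e : extension Z X, ext_split e.

Definition injective_in (S : E -> Prop) (P : E) : Prop :=
  S P /\ ext1_vanish S P.

(** ** Sub U *)

(* As isomorphisms are inflations, Sub U is closed under isomorphisms. *)
Inductive in_Sub (U : E) : E -> Prop :=
| Sub_self : in_Sub U U
| Sub_dirsum n (X : 'I_n -> E) (W : E) :
    (forall i, in_Sub U (X i)) -> is_dirsum X W -> in_Sub U W
| Sub_subobj (X Y : E) (i : mor X Y) : inflation i -> in_Sub U Y -> in_Sub U X.

End Exact.

(** ** Exact functors *)

Section ExactFunctors.
Variables (k : fieldType) (C D : seqCat k) (F : functor C D).

Definition is_exact_functor : Prop :=
  forall (X Y Z : C) (i : mor X Y) (p : mor Y Z),
    ses i p -> ses (fmap F i) (fmap F p).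

Definition ext_map (hF : is_exact_functor) (Z X : C) (e : extension Z X) :
    extension (F Z) (F X) :=
  Extension (hF _ _ _ _ _ (ext_ses e)).

(* The maps Ext^1(Z, X) -> Ext^1(F Z, F X) are bijective and linear. *)
Definition induces_ext1_iso (hF : is_exact_functor) : Prop :=
  forall Z X : C,
  [/\ forall e e' : extension Z X,
        ext_equiv (ext_map hF e) (ext_map hF e') -> ext_equiv e e',
      forall e : extension (F Z) (F X),
        exists e' : extension Z X, ext_equiv (ext_map hF e') e,
      forall e1 e2 e : extension Z X, baer_sum e1 e2 e ->
        baer_sum (ext_map hF e1) (ext_map hF e2) (ext_map hF e)
    & forall (a : k) (e e' : extension Z X), ext_scale a e e' ->
        ext_scale a (ext_map hF e) (ext_map hF e')].

Definition is_exact_equivalence : Prop :=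
  [/\ is_exact C, is_exact D, is_equivalence F
    & exists hF : is_exact_functor, induces_ext1_iso hF].

End ExactFunctors.

(** * Full subcategories *)

Section Full.
Variables (k : fieldType) (E : seqCat k) (S : E -> Prop).

Definition full_lin : linCat k :=
  @LinCat k {X : E | S X} (fun X Y => mor (sval X) (sval Y))
    (fun X => idm (sval X)) (fun X Y Z g f => g ∘ f)
    (fun W X Y Z h g f => compA h g f)
    (fun X Y f => comp1m f) (fun X Y f => compm1 f)
    (fun X Y Z f => comp_linearl f) (fun X Y Z g => comp_linearr g).

Definition full : seqCat k :=
  @SeqCat k full_lin
    (fun X Y Z i p => @ses k E (sval X) (sval Y) (sval Z) i p).

Program Definition full_incl : functor full E :=
  @Functor k full E (fun X => sval X) (fun X Y f => f) _ _ _.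
Next Obligation. by []. Qed.
Next Obligation. by []. Qed.
Next Obligation. by []. Qed.

(* The short exact sequences of the abelian category S are those of E with all
   terms in S. *)
Definition abelian_compatible : Prop :=
  is_abelian full /\
  forall (X Y Z : full) (i : mor X Y) (p : mor Y Z),
    ses i p <-> is_kernel i p /\ is_cokernel i p.

End Full.

(** * Quotient by the ideal of morphisms factoring through given objects *)

Section Quotient.
Variables (k : fieldType) (C : seqCat k) (A : C -> Prop).

(* The sum makes this an ideal for every A; it is superfluous as soon as A is
   closed under finite direct sums, see factor_idealP. *)
Definition factor_ideal (X Y : C) (f : mor X Y) : Prop :=
  exists n (W : 'I_n -> C) (h : forall i, mor (W i) Y)
    (g : forall i, mor X (W i)),
    (forall i, A (W i)) /\ f = \sum_i h i ∘ g i.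

Lemma factor_idealP
    (A_dirsum : forall n (W : 'I_n -> C), (forall i, A (W i)) ->
       exists V, A V /\ is_dirsum W V) (X Y : C) (f : mor X Y) :
  factor_ideal f <->
  exists (W : C) (h : mor W Y) (g : mor X W), A W /\ f = h ∘ g.
Proof.
split=> [[n [W [h [g [AW ->]]]]]|[W [h [g [AW ->]]]]]; last first.
  exists 1%N, (fun=> W), (fun=> h), (fun=> g); split=> //.
  by rewrite big_ord_recl big_ord0 addr0.
have [V [AV [s [r [rs rs0 _]]]]] := A_dirsum n W AW.
exists V, (\sum_i h i ∘ r i), (\sum_i s i ∘ g i); split=> //.
rewrite comp_suml; apply: eq_bigr => i _.
rewrite comp_sumr (bigD1 i) //= big1 => [|j ji].
  by rewrite addr0 compA -(compA (h i)) rs compm1.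
by rewrite compA -(compA (h i)) rs0 1?eq_sym // compm0 comp0m.
Qed.

Lemma factor_ideal_submod (X Y : C) : is_submod (@factor_ideal X Y).
Proof.
split=> [|a f f' [n [W [h [g [AW ->]]]]] [n' [W' [h' [g' [AW' ->]]]]]].
  exists 0%N, (fun=> X), (fun=> 0), (fun=> 0).
  by split=> [[]//|]; rewrite big_ord0.
pose V (i : 'I_n + 'I_n') := match i with inl i => W i | inr i => W' i end.
pose hV i : mor (V i) Y :=
  match i with inl i => a *: h i | inr i => h' i end.
pose gV i : mor X (V i) := match i with inl i => g i | inr i => g' i end.
exists (n + n')%N, (V \o split), (fun i => hV (split i)),
  (fun i => gV (split i)); split=> [i /=|]; first by case: (split i) => j /=.
pose D u : mor X Y := hV u ∘ gV u.
rewrite -[RHS]/(\sum_i D (split i)) big_split_ord scaler_sumr.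
congr (_ + _); apply: eq_bigr => i _.
  by rewrite -[lshift _ _]/(unsplit (inl i)) unsplitK /D /= compZl.
by rewrite -[rshift _ _]/(unsplit (inr i)) unsplitK.
Qed.

Lemma factor_ideal_compl (X Y Z : C) (f : mor X Y) (u : mor Y Z) :
  factor_ideal f -> factor_ideal (u ∘ f).
Proof.
move=> [n [W [h [g [AW ->]]]]]; exists n, W, (fun i => u ∘ h i), g; split=> //.
by rewrite comp_sumr; apply: eq_bigr => i _; rewrite compA.
Qed.

Lemma factor_ideal_compr (X Y Z : C) (f : mor Y Z) (u : mor X Y) :
  factor_ideal f -> factor_ideal (f ∘ u).
Proof.
move=> [n [W [h [g [AW ->]]]]]; exists n, W, h, (fun i => g i ∘ u); split=> //.
by rewrite comp_suml; apply: eq_bigr => i _; rewrite compA.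
Qed.

Definition quot_hom (X Y : C) : lmodType k := lquot (factor_ideal_submod X Y).

Definition quot_pi (X Y : C) (f : mor X Y) : quot_hom X Y :=
  lquot_pi (factor_ideal_submod X Y) f.

Definition quot_comp (X Y Z : C) (g : quot_hom Y Z) (f : quot_hom X Y) :
    quot_hom X Z :=
  quot_pi (repr g ∘ repr f).

Lemma quot_piE (X Y : C) (f g : mor X Y) :
  quot_pi f = quot_pi g <-> factor_ideal (f - g).
Proof. exact: lquot_piE. Qed.

Lemma quot_reprK (X Y : C) (f : quot_hom X Y) : quot_pi (repr f) = f.
Proof. exact: lquot_reprK. Qed.

Lemma quot_pi_comp (X Y Z : C) (g : mor Y Z) (f : mor X Y) :
  quot_comp (quot_pi g) (quot_pi f) = quot_pi (g ∘ f).
Proof.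
apply/quot_piE.
set g' := repr (quot_pi g); set f' := repr (quot_pi f).
have -> : g' ∘ f' - g ∘ f = 1 *: (g' ∘ (f' - f)) + (g' - g) ∘ f.
  by rewrite scale1r compBr compBl subrKA.
apply: (proj2 (factor_ideal_submod X Z)).
  by apply: factor_ideal_compl; apply: lquot_repr.
by apply: factor_ideal_compr; apply: lquot_repr.
Qed.

Lemma quot_pi_linear (X Y : C) : linear (@quot_pi X Y).
Proof. exact: lquot_pi_linear. Qed.

Program Definition quot_lin : linCat k :=
  @LinCat k C quot_hom (fun X => quot_pi (idm X)) quot_comp _ _ _ _ _.
Next Obligation.
move=> W X Y Z h g f.
rewrite -(quot_reprK h) -(quot_reprK g) -(quot_reprK f).
by rewrite !quot_pi_comp compA.
Qed.
Next Obligation.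
by move=> X Y f; rewrite -(quot_reprK f) quot_pi_comp comp1m.
Qed.
Next Obligation.
by move=> X Y f; rewrite -(quot_reprK f) quot_pi_comp compm1.
Qed.
Next Obligation.
move=> X Y Z f a g g'.
rewrite -(quot_reprK f) -(quot_reprK g) -(quot_reprK g').
by rewrite -quot_pi_linear !quot_pi_comp comp_linearl quot_pi_linear.
Qed.
Next Obligation.
move=> X Y Z g a f f'.
rewrite -(quot_reprK g) -(quot_reprK f) -(quot_reprK f').
by rewrite -quot_pi_linear !quot_pi_comp comp_linearr quot_pi_linear.
Qed.

Program Definition quot_functor : functor C quot_lin :=
  @Functor k C quot_lin (fun X => X) quot_pi _ _ _.
Next Obligation. exact: quot_pi_linear. Qed.
Next Obligation. by []. Qed.
Next Obligation. by move=> X Y Z g f; rewrite -quot_pi_comp. Qed.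

Definition quot_ses (X Y Z : quot_lin) (i : mor X Y) (p : mor Y Z) : Prop :=
  exists (X' Y' Z' : C) (i' : mor X' Y') (p' : mor Y' Z')
    (a : mor (quot_functor X') X) (b : mor (quot_functor Y') Y)
    (c : mor (quot_functor Z') Z),
    [/\ ses i' p', is_iso a, is_iso b & is_iso c] /\
    b ∘ fmap quot_functor i' = i ∘ a /\ c ∘ fmap quot_functor p' = p ∘ b.

Definition quot : seqCat k := @SeqCat k quot_lin quot_ses.

End Quotient.

(* The sequence 0 -> P -> C^P -> U^P -> 0 defining U^P.  It is unique up to
   isomorphism when (B, C) is a torsion pair, but its existence does not follow
   from (A, B) and (B, C) being torsion pairs in a Hom-finite Krull-Schmidt
   exact category with enough projectives, all of them in C, with A = add P for
   some P projective and injective in C, and with B abelian and compatible.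
   Take the finite-dimensional representations of the quiver
     ... -> 3 -> 2 -> 1 -> 0,
   P the simple at 0, B the representations vanishing at 0, C the projectives:
   B has no nonzero injective object, and U^P would have to be the injective
   hull in B of the simple at 1. *)
Definition is_U_sequence (k : fieldType) (E : seqCat k) (B C : E -> Prop)
    (P CP : E) (UP : full B) (i : mor P CP) (p : mor CP (full_incl B UP))
  : Prop :=
  [/\ ses i p, C CP & ext1_vanish B CP].

(* Main.v *)
(* Write L X for the torsion-free quotient X / tX of X for the pair (A, B); L is
   the left adjoint of the inclusion of B, and tX is in add P.

   On C, L is full because Ext^1(C, P) = 0, and it kills exactly the morphisms
   factoring through A, so it induces a fully faithful functor on C/[A].

   For X in C, the vanishing of Ext^1(B, C^P) lets the components tX -> P -> C^P
   extend to X, hence gives morphisms from L X to copies of U.  If they all kill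
   a subobject K of L X, the sequence tX -> X -> L X splits over K, so K embeds
   into X; as Hom(B, C) = 0, K = 0, and L X is in Sub U.  Conversely, V in Sub U
   is L X for the pullback X of a sequence P^n -> (C^P)^n -> U^n along an
   inclusion of V in U^n.

   For Z in B or C and 0 -> K -> Q -> Z -> 0 with Q projective, K is in C, so
   Ext^2(Z, P) = Ext^1(K, P) = 0.  This makes U injective in B, and lifts
   extensions of L Z by L X to extensions of Z by X. *)
Require Import Defs.
From HB Require Import structures.
From mathcomp Require Import all_boot all_order all_algebra.
From mathcomp Require Import boolp.
Import Defs.

Set Implicit Arguments.
Unset Strict Implicit.
Unset Printing Implicit Defensive.

Import GRing.Theory.
Local Open Scope ring_scope.

(** * Kernels, cokernels and duality in linear categories *)

Section LinearCategory.
Variables (k : fieldType) (C : linCat k).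

Lemma ker_mono0 (X Y Z W : C) (i : mor X Y) (p : mor Y Z) (g : mor W X) :
  is_kernel i p -> i ∘ g = 0 -> g = 0.
Proof.
move=> [_ ker] ig0; have [u [_ uP]] := ker W 0 (compm0 _ p).
by rewrite -(uP _ ig0); apply: uP; rewrite compm0.
Qed.

Lemma ker_mono (X Y Z : C) (i : mor X Y) (p : mor Y Z) :
  is_kernel i p -> is_mono i.
Proof.
move=> ker W g g' eqg; apply/subr0_eq/(ker_mono0 ker).
by rewrite compBr eqg subrr.
Qed.

Lemma ker_lift (X Y Z W : C) (i : mor X Y) (p : mor Y Z) (f : mor W Y) :
  is_kernel i p -> p ∘ f = 0 -> exists g, i ∘ g = f.
Proof. by move=> [_ ker] /ker[g [gf _]]; exists g. Qed.

Lemma is_kernelI (X Y Z : C) (i : mor X Y) (p : mor Y Z) :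
  p ∘ i = 0 -> (forall W (g : mor W X), i ∘ g = 0 -> g = 0) ->
  (forall W (f : mor W Y), p ∘ f = 0 -> exists g, i ∘ g = f) ->
  is_kernel i p.
Proof.
move=> pi0 inj lft; split=> // W f /lft[g <-]; exists g; split=> // g' eqg.
by apply/subr0_eq/inj; rewrite compBr eqg subrr.
Qed.

(** A kernel in [op_lin C] unfolds to a cokernel in [C], so statements about cokernels follow from
    those about kernels by conversion. *)
Definition op_lin : linCat k :=
  @LinCat k C (fun X Y => mor Y X) (fun X => idm X) (fun X Y Z g f => f ∘ g)
    (fun W X Y Z h g f => esym (compA f g h))
    (fun X Y f => compm1 f) (fun X Y f => comp1m f)
    (fun X Y Z f => comp_linearr f) (fun X Y Z g => comp_linearl g).

Lemma isoV (X Y : C) (f : mor X Y) :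
  is_iso f -> exists g, [/\ g ∘ f = idm X, f ∘ g = idm Y & is_iso g].
Proof. by move=> [g [gf fg]]; exists g; split=> //; exists f. Qed.

Lemma iso1 (X : C) : is_iso (idm X).
Proof. by exists (idm X); rewrite comp1m. Qed.

Lemma isoM (X Y Z : C) (g : mor Y Z) (f : mor X Y) :
  is_iso g -> is_iso f -> is_iso (g ∘ f).
Proof.
move=> [g' [gg' g'g]] [f' [ff' f'f]]; exists (f' ∘ g'); split.
  by rewrite compA -(compA f') gg' compm1.
by rewrite compA -(compA g) f'f compm1.
Qed.

End LinearCategory.

Section Dual.
Variables (k : fieldType) (C : linCat k).

Lemma coker_epi0 (X Y Z W : C) (i : mor X Y) (p : mor Y Z) (g : mor Z W) :
  is_cokernel i p -> g ∘ p = 0 -> g = 0.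
Proof. exact: (@ker_mono0 _ (op_lin C)). Qed.

Lemma coker_epi (X Y Z : C) (i : mor X Y) (p : mor Y Z) :
  is_cokernel i p -> is_epi p.
Proof. exact: (@ker_mono _ (op_lin C)). Qed.

Lemma coker_lift (X Y Z W : C) (i : mor X Y) (p : mor Y Z) (f : mor Y W) :
  is_cokernel i p -> f ∘ i = 0 -> exists g, g ∘ p = f.
Proof. exact: (@ker_lift _ (op_lin C)). Qed.

Lemma is_cokernelI (X Y Z : C) (i : mor X Y) (p : mor Y Z) :
  p ∘ i = 0 -> (forall W (g : mor Z W), g ∘ p = 0 -> g = 0) ->
  (forall W (f : mor Y W), f ∘ i = 0 -> exists g, g ∘ p = f) ->
  is_cokernel i p.
Proof. exact: (@is_kernelI _ (op_lin C)). Qed.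

Lemma coker_iso (X Y Z Z' : C) (i : mor X Y) (p : mor Y Z) (p' : mor Y Z') :
  is_cokernel i p -> is_cokernel i p' -> exists c, is_iso c /\ c ∘ p = p'.
Proof.
move=> cp cp'.
have [c cpE] := coker_lift cp (proj1 cp').
have [d dpE] := coker_lift cp' (proj1 cp).
exists c; split=> //; exists d; split.
  by apply: (coker_epi cp); rewrite -compA cpE dpE comp1m.
by apply: (coker_epi cp'); rewrite -compA dpE cpE comp1m.
Qed.

Lemma iso_op (X Y : C) (f : mor X Y) :
  is_iso f <-> @is_iso _ (op_lin C) Y X f.
Proof. by split=> -[g [gf fg]]; exists g. Qed.

Lemma dirsum_op n (X : 'I_n -> C) (W : C) :
  is_dirsum X W <-> @is_dirsum _ (op_lin C) n X W.
Proof.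
by split=> -[s [r [rs rs0 sr]]]; exists r, s; split=> // i j ij;
  apply: rs0; rewrite eq_sym.
Qed.

End Dual.

(** * The opposite of an exact category *)

Section OpExact.
Variables (k : fieldType) (E : seqCat k).

Definition op : seqCat k := @SeqCat k (op_lin E) (fun X Y Z i p => ses p i).

Hypothesis hE : is_exact E.

Lemma op_exact : is_exact op.
Proof.
split.
- by move=> n X; have [W /dirsum_op] := exact_additive hE X; exists W.
- by move=> X Y Z i p; apply: (ses_cokernel hE).
- by move=> X Y Z i p; apply: (ses_kernel hE).
- move=> X Y Z X' Y' Z' i p i' p' a b c /iso_op/isoV[a' [aa a'a ia]].
  move=> /iso_op/isoV[b' [bb b'b ib]] /iso_op/isoV[c' [cc c'c ic]].
  rewrite /= => eqi eqp; apply: (ses_iso hE ic ib ia).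
    rewrite -[RHS]comp1m -bb -!compA; congr (_ ∘ _).
    by rewrite compA -eqp -compA c'c compm1.
  rewrite -[RHS]comp1m -aa -!compA; congr (_ ∘ _).
  by rewrite compA -eqi -compA b'b compm1.
- by move=> X; apply: (deflation1 hE).
- by move=> X; apply: (inflation1 hE).
- by move=> X Y Z f g hf hg; apply: (deflationM hE).
- by move=> X Y Z f g hf hg; apply: (inflationM hE).
- by move=> X Y X' i f; apply: (deflation_pullback hE).
- by move=> X Y X' i f; apply: (inflation_pushout hE).
Qed.

End OpExact.

(** * Pushouts, pullbacks and vanishing of Ext^1 in an exact category *)

Section ExactPushout.
Variables (k : fieldType) (E : seqCat k) (hE : is_exact E).

Lemma ses_comp0 (X Y Z : E) (i : mor X Y) (p : mor Y Z) :
  ses i p -> p ∘ i = 0.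
Proof. by move/(ses_kernel hE)=> []. Qed.

Lemma inflation_coker_ses (X Y Z : E) (i : mor X Y) (p : mor Y Z) :
  inflation i -> is_cokernel i p -> ses i p.
Proof.
move=> [Z' [p' sip']] cp.
have [c [ic cE]] := coker_iso (ses_cokernel hE sip') cp.
apply: (ses_iso hE (iso1 X) (iso1 Y) ic _ _ sip').
  by rewrite comp1m compm1.
by rewrite cE compm1.
Qed.

Lemma ses_iso_r (X Y Z Z' : E) (i : mor X Y) (p : mor Y Z) (c : mor Z Z') :
  ses i p -> is_iso c -> ses i (c ∘ p).
Proof.
move=> sip ic; apply: (ses_iso hE (iso1 X) (iso1 Y) ic _ _ sip).
  by rewrite comp1m compm1.
by rewrite compm1.
Qed.

(** The morphism [p'] is induced by [p] and [0]; the universal property of the pushout makes it a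
    cokernel of [i']. *)
Lemma pushout_ses (X Y Z X' : E) (i : mor X Y) (p : mor Y Z) (f : mor X X') :
  ses i p -> exists Y' (i' : mor X' Y') (f' : mor Y Y') (p' : mor Y' Z),
    [/\ ses i' p', is_pushout i f i' f' & p' ∘ f' = p].
Proof.
move=> sip; have cp := ses_cokernel hE sip.
have [Y' [i' [f' [[fi po] ii']]]] :
    exists Y' (i' : mor X' Y') (f' : mor Y Y'),
      is_pushout i f i' f' /\ inflation i'.
  by apply: (inflation_pushout hE); exists Z, p.
have [p' [[pf pi0] _]] : exists! w, w ∘ f' = p /\ w ∘ i' = 0.
  by apply: po; rewrite (proj1 cp) comp0m.
exists Y', i', f', p'; split=> //; apply: inflation_coker_ses => //.
apply: is_cokernelI => // W h.
  by move=> hp; apply: (coker_epi0 cp); rewrite -pf compA hp comp0m.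
move=> hi; have hfi : h ∘ f' ∘ i = 0 by rewrite -compA fi compA hi comp0m.
have [g gp] := coker_lift cp hfi; exists g.
have [|w [_ wU]] := po W (h ∘ f') 0; first by rewrite hfi comp0m.
by rewrite -[h](wU h) ?hi //; apply/esym/wU; rewrite -!compA pf gp pi0 compm0.
Qed.

(* Noether's isomorphism (Z/X)/(Y/X) = Z/Y. *)
Lemma inflation_comp_ses (X Y Z Q R : E) (f : mor X Y) (q : mor Y Q)
    (g : mor Y Z) (r : mor Z R) :
  ses f q -> ses g r -> exists W (c : mor Z W) (u : mor Q W) (v : mor W R),
    [/\ ses (g ∘ f) c, ses u v, c ∘ g = u ∘ q & v ∘ c = r].
Proof.
move=> sfq sgr; have cq := ses_cokernel hE sfq.
have [W [u [c [v [suv [cg po] vc]]]]] := pushout_ses q sgr.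
exists W, c, u, v; split=> //; apply: inflation_coker_ses.
  by apply: (inflationM hE); [exists Q, q | exists R, r].
apply: is_cokernelI; first by rewrite compA cg -compA (proj1 cq) compm0.
  move=> T h hc; have hu : h ∘ u = 0.
    by apply: (coker_epi0 cq); rewrite -compA -cg compA hc comp0m.
  have [|w [_ wU]] := po T 0 0; first by rewrite !comp0m.
  by rewrite -[h](wU h) //; apply: wU; rewrite !comp0m.
move=> T h; rewrite compA => hgf; have [g' g'q] := coker_lift cq hgf.
by have [w [[wc _] _]] := po T h g' (esym g'q); exists w.
Qed.

(** The pushout of the sequence along [f] is an extension of [Z] by [T], so it splits; a retraction
    onto [T] composed with [f'] extends [f]. *)
Lemma ext1_vanish_extend (S : E -> Prop) (X Y Z T : E) (i : mor X Y)
    (p : mor Y Z) (f : mor X T) :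
  ext1_vanish S T -> S Z -> ses i p -> exists g : mor Y T, g ∘ i = f.
Proof.
move=> vT SZ sip; have [W [j [f' [q [sjq [fi _] _]]]]] := pushout_ses f sip.
have [s /= qs] := vT Z SZ (Extension sjq).
have [r rE] : exists r, j ∘ r = idm W - s ∘ q.
  apply: (ker_lift (ses_kernel hE sjq)).
  by rewrite compBr compm1 compA qs comp1m subrr.
exists (r ∘ f'); apply: (ker_mono (ses_kernel hE sjq)).
rewrite !compA rE -compA fi compA compBl comp1m -(compA s).
by rewrite (ses_comp0 sjq) compm0 subr0.
Qed.

Lemma ses_retract (X Y Z : E) (i : mor X Y) (p : mor Y Z) (r : mor Y X) :
  ses i p -> r ∘ i = idm X -> exists s, p ∘ s = idm Z /\ s ∘ p = idm Y - i ∘ r.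
Proof.
move=> sip ri.
have [s sE] : exists s, s ∘ p = idm Y - i ∘ r.
  apply: (coker_lift (ses_cokernel hE sip)).
  by rewrite compBl comp1m -compA ri compm1 subrr.
exists s; split=> //; apply: (coker_epi (ses_cokernel hE sip)).
by rewrite -compA sE compBr compA (ses_comp0 sip) comp0m subr0 compm1 comp1m.
Qed.

(** In an extension of [Z] by [T], each [a j] extends to the middle term; recombining these with the
    [b j] gives a retraction onto [T]. *)
Lemma ext1_vanish_retract (S : E -> Prop) (P T : E) n
    (a : 'I_n -> mor T P) (b : 'I_n -> mor P T) :
  ext1_vanish S P -> \sum_j b j ∘ a j = idm T -> ext1_vanish S T.
Proof.
move=> vP ba Z SZ e.
have /choice[g gE] : forall j, exists g, g ∘ ext_inf e = a j.
  by move=> j; apply: (ext1_vanish_extend (a j) vP SZ (ext_ses e)).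
have [|s [es _]] := ses_retract (r := \sum_j b j ∘ g j) (ext_ses e).
  by rewrite comp_suml -ba; apply: eq_bigr => j _; rewrite -compA gE.
by exists s.
Qed.

(** The predicate [eq Z] is the class of the single object [Z], so that vanishing passes from [S] to
    objects merely isomorphic to a member of it. *)
Lemma ext1_vanish_iso (S : E -> Prop) (Z Z' T : E) (c : mor Z Z') :
  ext1_vanish S T -> S Z' -> is_iso c -> ext1_vanish (eq Z) T.
Proof.
move=> vT SZ ic _ <- e.
have [s /= es] := vT _ SZ (Extension (ses_iso_r (ext_ses e) ic)).
exists (s ∘ c); have [c' [c'c cc' _]] := isoV ic.
by rewrite -[LHS]comp1m -c'c -compA (compA c) !(compA _ s) es comp1m.
Qed.

End ExactPushout.

Section ExactPullback.
Variables (k : fieldType) (E : seqCat k) (hE : is_exact E).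

Lemma pullback_ses (X Y Z Z' : E) (i : mor X Y) (p : mor Y Z) (f : mor Z' Z) :
  ses i p -> exists Y' (p' : mor Y' Z') (f' : mor Y' Y) (i' : mor X Y'),
    [/\ ses i' p', is_pullback p f p' f' & f' ∘ i' = i].
Proof. exact: (pushout_ses (op_exact hE)). Qed.

Lemma deflation_comp_ses (X Y Z Q R : E) (f : mor Y X) (q : mor Q Y)
    (g : mor Z Y) (r : mor R Z) :
  ses q f -> ses r g -> exists W (c : mor W Z) (u : mor W Q) (v : mor R W),
    [/\ ses c (f ∘ g), ses v u, g ∘ c = q ∘ u & c ∘ v = r].
Proof. exact: (inflation_comp_ses (op_exact hE)). Qed.

Lemma ext1_vanish_lift (S : E -> Prop) (X Y T Z : E) (i : mor T Y)
    (p : mor Y Z) (f : mor X Z) :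
  ext1_vanish S T -> S X -> ses i p -> exists g, p ∘ g = f.
Proof.
move=> vT SX sip; have [W [q [f' [j [sjq [pf _] _]]]]] := pullback_ses f sip.
have [s /= qs] := vT X SX (Extension sjq).
by exists (f' ∘ s); rewrite compA pf -compA qs compm1.
Qed.

Lemma ses_iso_mid (X Y Y' Z : E) (i : mor X Y) (p : mor Y Z) (b : mor Y Y')
    (b' : mor Y' Y) :
  ses i p -> b' ∘ b = idm Y -> b ∘ b' = idm Y' -> ses (b ∘ i) (p ∘ b').
Proof.
move=> sip b'b bb'; apply: (ses_iso hE (iso1 X) _ (iso1 Z) _ _ sip).
- by exists b'; split; [exact: b'b|].
- by rewrite compm1.
- by rewrite -compA b'b compm1 comp1m.
Qed.

End ExactPullback.

(** * Fully faithful functors and equivalences *)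

Section FunctorTheory.
Variables (k : fieldType) (C D : linCat k) (F : functor C D).

Lemma fmap_sum (X Y : C) n (f : 'I_n -> mor X Y) :
  fmap F (\sum_i f i) = \sum_i fmap F (f i).
Proof.
pose l := GRing.isLinear.Build k (mor X Y) (mor (F X) (F Y)) *:%R _
            (@fmap_linear _ _ _ F X Y).
pose G : {linear mor X Y -> mor (F X) (F Y)} := HB.pack (@fmap _ _ _ F X Y) l.
exact: (linear_sum G).
Qed.

Lemma fmapD (X Y : C) (f g : mor X Y) : fmap F (f + g) = fmap F f + fmap F g.
Proof. by have := fmap_linear F 1 f g; rewrite !scale1r. Qed.

Lemma fmap0 (X Y : C) : fmap F (0 : mor X Y) = 0.
Proof. by apply: (addrI (fmap F 0)); rewrite -fmapD !addr0. Qed.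

Lemma fmapZ (X Y : C) a (f : mor X Y) : fmap F (a *: f) = a *: fmap F f.
Proof. by have := fmap_linear F a f 0; rewrite fmap0 !addr0. Qed.

Lemma fmapB (X Y : C) (f g : mor X Y) : fmap F (f - g) = fmap F f - fmap F g.
Proof. by rewrite fmapD -scaleN1r fmapZ scaleN1r. Qed.

Lemma fmap_iso (X Y : C) (f : mor X Y) : is_iso f -> is_iso (fmap F f).
Proof.
by move=> [g [gf fg]]; exists (fmap F g); rewrite -!fmapM gf fg !fmap1.
Qed.

Definition is_full : Prop :=
  forall (X Y : C) (g : mor (F X) (F Y)), exists f, fmap F f = g.

Definition is_faithful : Prop :=
  forall (X Y : C) (f : mor X Y), fmap F f = 0 -> f = 0.

Definition ess_surjective : Prop :=
  forall Y : D, exists X (b : mor (F X) Y), is_iso b.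

Lemma faithful_inj (X Y : C) : is_faithful -> injective (@fmap _ _ _ F X Y).
Proof. by move=> fth f g eqF; apply/subr0_eq/fth; rewrite fmapB eqF subrr. Qed.

Lemma ff_iso (X Y : C) (f : mor X Y) :
  is_full -> is_faithful -> is_iso (fmap F f) -> is_iso f.
Proof.
move=> ful fth [g' [gf fg]]; have [g gE] := ful _ _ g'; exists g.
by split; apply: faithful_inj => //; rewrite fmapM gE fmap1.
Qed.

Lemma full_family I (X Y : I -> C) (g : forall i, mor (F (X i)) (F (Y i))) :
  is_full -> exists f : forall i, mor (X i) (Y i), forall i, fmap F (f i) = g i.
Proof.
move=> ful; exists (fun i => projT1 (cid (ful _ _ (g i)))) => i.
exact: projT2 (cid (ful _ _ (g i))).
Qed.

Definition op_functor : functor (op_lin C) (op_lin D) :=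
  @Functor k (op_lin C) (op_lin D) F (fun X Y f => fmap F f)
    (fun X Y => @fmap_linear _ _ _ F Y X) (fmap1 F)
    (fun X Y Z g f => fmapM F f g).

Lemma ff_equivalence :
  is_full -> is_faithful -> ess_surjective -> is_equivalence F.
Proof.
move=> ful fth ess; have inj X Y := @faithful_inj X Y fth.
have iv Y : {X & {u : mor (F X) Y & {v : mor Y (F X) |
    v ∘ u = idm (F X) /\ u ∘ v = idm Y}}}.
  by have /cid[X /cid[u /cid[v vP]]] := ess Y; exists X, u, v.
pose G0 Y := projT1 (iv Y).
pose u Y : mor (F (G0 Y)) Y := projT1 (projT2 (iv Y)).
pose v Y : mor Y (F (G0 Y)) := sval (projT2 (projT2 (iv Y))).
have vu Y : v Y ∘ u Y = idm _ := proj1 (svalP (projT2 (projT2 (iv Y)))).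
have uv Y : u Y ∘ v Y = idm _ := proj2 (svalP (projT2 (projT2 (iv Y)))).
(* Conjugation by the chosen isomorphisms, lifted along [F] by fullness. *)
pose G1 Y Y' (f : mor Y Y') : mor (G0 Y) (G0 Y') :=
  projT1 (cid (ful _ _ (v Y' ∘ f ∘ u Y))).
have G1E Y Y' (f : mor Y Y') : fmap F (G1 Y Y' f) = v Y' ∘ f ∘ u Y.
  exact: projT2 (cid (ful _ _ (v Y' ∘ f ∘ u Y))).
have G_lin Y Y' : linear (G1 Y Y').
  move=> a f g; apply: inj; rewrite fmap_linear !G1E.
  by rewrite comp_linearr comp_linearl.
have G_1 Y : G1 Y Y (idm Y) = idm _.
  by apply: inj; rewrite G1E compm1 vu fmap1.
have G_M X Y Z (g : mor Y Z) (f : mor X Y) :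
    G1 X Z (g ∘ f) = G1 _ _ g ∘ G1 _ _ f.
  by apply: inj; rewrite fmapM !G1E !compA -(compA _ (u Y)) uv compm1.
pose G := @Functor k D C G0 G1 G_lin G_1 G_M.
exists G; split.
  pose t X : mor (G0 (F X)) X := projT1 (cid (ful _ _ (u (F X)))).
  have tE X : fmap F (t X) = u (F X) := projT2 (cid (ful _ _ (u (F X)))).
  exists t; split=> [X|X Y f].
    by apply: (ff_iso ful fth); rewrite tE; exists (v (F X)); rewrite vu uv.
  by apply: inj; rewrite !fmapM !tE [fmap F (fmap _ _)]G1E !compA uv comp1m.
exists u; split=> [Y|Y Y' f]; first by exists (v Y); rewrite /= vu uv.
by rewrite [fmap _ f]G1E !compA uv comp1m.
Qed.

End FunctorTheory.

(** * Restriction of an exact structure along a fully faithful functor *)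

Section TransportHalf.
Variables (k : fieldType) (C D : seqCat k) (F : functor C D).

(* Satisfied by inclusions of extension-closed additive subcategories as well as
   by equivalences that preserve and reflect short exact sequences; the exact
   structure of D then restricts to C. *)
Record reflects_exact : Prop := ReflectsExact {
  rfl_full : is_full F;
  rfl_faithful : is_faithful F;
  rfl_ses : forall (X Y Z : C) (i : mor X Y) (p : mor Y Z),
    ses i p <-> ses (fmap F i) (fmap F p);
  rfl_dirsum : forall n (X : 'I_n -> C) (W : D),
    is_dirsum (fun i => F (X i)) W -> exists Y (b : mor (F Y) W), is_iso b;
  rfl_ext : forall (X Z : C) (Y : D) (i : mor (F X) Y) (p : mor Y (F Z)),
    ses i p -> exists Y' (b : mor (F Y') Y), is_iso b
}.

Hypotheses (hD : is_exact D) (hF : reflects_exact).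

Let ful := rfl_full hF.
Let fth := rfl_faithful hF.
Let rses := rfl_ses hF.
Let Finj X Y := @faithful_inj _ _ _ F X Y fth.

(** The cokernel of an identity is a zero object; [rfl_dirsum] for the empty family supplies an
    object of [C] that [F] sends to one. *)
Lemma rfl_inflation1 (X : C) : inflation (idm X).
Proof.
have [W W_sum] := exact_additive hD (fun _ : 'I_0 => F X).
have [Y [b [b' [b'b bb']]]] := rfl_dirsum hF W_sum.
have W0 : idm W = 0 by case: W_sum => s [r [_ _ <-]]; rewrite big_ord0.
have Y0 : idm (F Y) = 0 by rewrite -b'b -[b]comp1m W0 comp0m compm0.
have [Z [p sp]] := inflation1 hD (F X).
have Z0 : idm Z = 0.
  apply: (coker_epi0 (ses_cokernel hD sp)).
  by rewrite -[LHS]compm1 -compA (ses_comp0 hD sp) compm0.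
exists Y, 0; apply/rses; rewrite fmap1 fmap0 -(comp0m (F Y) p).
by apply: (ses_iso_r hD sp); exists 0; rewrite !comp0m Z0 Y0.
Qed.

Lemma rfl_lift (X Z : C) (Y : D) (i : mor (F X) Y) (p : mor Y (F Z)) :
  ses i p -> exists Y' (b : mor (F Y') Y) (b' : mor Y (F Y')) (i0 : mor X Y')
    (p0 : mor Y' Z),
    [/\ b' ∘ b = idm (F Y') /\ b ∘ b' = idm Y, ses i0 p0,
        fmap F i0 = b' ∘ i & fmap F p0 = p ∘ b].
Proof.
move=> sip; have [Y' [b [b' [b'b bb']]]] := rfl_ext hF sip.
have [i0 i0E] := ful (b' ∘ i); have [p0 p0E] := ful (p ∘ b).
exists Y', b, b', i0, p0; split=> //; apply/rses; rewrite i0E p0E.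
exact: ses_iso_mid.
Qed.

Lemma rfl_cokernel (X Y Z : C) (i : mor X Y) (p : mor Y Z) :
  ses i p -> is_cokernel i p.
Proof.
move=> /rses sip; have cp := ses_cokernel hD sip; apply: is_cokernelI.
- by apply: fth; rewrite fmapM (proj1 cp).
- by move=> W g gp; apply/fth/(coker_epi0 cp); rewrite -fmapM gp fmap0.
move=> W f fi; have [|g' g'E] := coker_lift (f := fmap F f) cp.
  by rewrite -fmapM fi fmap0.
by have [g gE] := ful g'; exists g; apply: Finj; rewrite fmapM gE.
Qed.

(** The cokernel of the composite is an extension of [F R] by [F Q], hence up to isomorphism in the
    image of [F]. *)
Lemma rfl_inflationM (X Y Z : C) (f : mor X Y) (g : mor Y Z) :
  inflation f -> inflation g -> inflation (g ∘ f).
Proof.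
move=> [Q [q /rses sfq]] [R [r /rses sgr]].
have [W [c [u [v [sgf suv _ _]]]]] := inflation_comp_ses hD sfq sgr.
have [W' [b [b' [u0 [v0 [[b'b bb'] _ _ _]]]]]] := rfl_lift suv.
have [c0 c0E] := ful (b' ∘ c).
exists W', c0; apply/rses; rewrite fmapM c0E.
by apply: (ses_iso_r hD sgf); exists b.
Qed.

(** The pushout in [D] is an extension of [F Z] by [F X'], hence isomorphic to an object in the
    image of [F]; full faithfulness transports its universal property. *)
Lemma rfl_pushout (X Y X' : C) (i : mor X Y) (f : mor X X') :
  inflation i -> exists Y' (i' : mor X' Y') (f' : mor Y Y'),
    is_pushout i f i' f' /\ inflation i'.
Proof.
move=> [Z [p /rses sip]].
have [W [i' [f' [p' [si'p' [eqf po] _]]]]] := pushout_ses hD (fmap F f) sip.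
have [Y' [b [b' [i0 [p0 [[b'b bb'] si0p0 i0E p0E]]]]]] := rfl_lift si'p'.
have [f0 f0E] := ful (b' ∘ f').
exists Y', i0, f0; split; last by exists Z, p0.
split; first by apply: Finj; rewrite !fmapM i0E f0E -!compA eqf.
move=> T u v uv; have [|w [[wf wi] wU]] := po _ (fmap F u) (fmap F v).
  by rewrite -!fmapM uv.
have [w0 w0E] := ful (w ∘ b); exists w0; split.
  by split; apply: Finj;
    rewrite fmapM w0E ?i0E ?f0E -compA (compA b) bb' comp1m.
move=> w1 [w1f w1i]; apply: Finj; rewrite w0E.
rewrite [w](_ : _ = fmap F w1 ∘ b'); first by rewrite -compA b'b compm1.
by apply: wU; rewrite -!compA -f0E -i0E -!fmapM w1f w1i.
Qed.

End TransportHalf.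

Section Transport.
Variables (k : fieldType) (C D : seqCat k) (F : functor C D).
Hypotheses (hD : is_exact D) (hF : reflects_exact F).

(** The conditions are self-dual, so the axioms proved above for inflations and cokernels, applied
    to the opposite categories, give those for deflations and kernels. *)
Lemma op_reflects_exact :
  @reflects_exact _ (op C) (op D) (op_functor F).
Proof.
split.
- by move=> X Y; apply: (rfl_full hF).
- by move=> X Y; apply: (rfl_faithful hF).
- by move=> X Y Z i p; apply: (rfl_ses hF).
- move=> n X W /dirsum_op /(rfl_dirsum hF)[Y [b /isoV[b' [_ _ ib]]]].
  by exists Y, b'; apply/iso_op.
- move=> X Z Y i p /(rfl_ext hF)[Y' [b /isoV[b' [_ _ ib]]]].
  by exists Y', b'; apply/iso_op.
Qed.

Lemma reflects_exact_exact : is_exact C.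
Proof.
have [ful fth rses _ _] := hF; have hFop := op_reflects_exact.
have Finj X Y := @faithful_inj _ _ _ F X Y fth.
split.
- move=> n X; have [W W_sum] := exact_additive hD (F \o X).
  have [Y [b [b' [b'b bb']]]] := rfl_dirsum hF W_sum; exists Y.
  have [s [r [rs rs0 sr]]] := W_sum.
  have [s0 s0E] := full_family (fun i => b' ∘ s i) ful.
  have [r0 r0E] := full_family (fun i => r i ∘ b) ful.
  exists s0, r0; split=> [i|i j ij|]; apply: Finj.
  + by rewrite fmapM s0E r0E fmap1 compA -(compA _ b) bb' compm1 rs.
  + by rewrite fmapM s0E r0E fmap0 compA -(compA _ b) bb' compm1 rs0.
  rewrite fmap_sum fmap1 -b'b -[b in RHS]comp1m -sr comp_suml comp_sumr.
  by apply: eq_bigr => i _; rewrite fmapM s0E r0E !compA.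
- by move=> X Y Z i p; apply: (rfl_cokernel (op_exact hD) hFop).
- by move=> X Y Z i p; apply: (rfl_cokernel hD hF).
- move=> X Y Z X' Y' Z' i p i' p' a b c ia ib ic eqi eqp /rses sip; apply/rses.
  apply: (ses_iso hD (fmap_iso F ia) (fmap_iso F ib) (fmap_iso F ic) _ _ sip).
    by rewrite -!fmapM eqi.
  by rewrite -!fmapM eqp.
- exact: (rfl_inflation1 hD hF).
- exact: (rfl_inflation1 (op_exact hD) hFop).
- by move=> X Y Z f g; apply: (rfl_inflationM hD hF).
- by move=> X Y Z f g hf hg; apply: (rfl_inflationM (op_exact hD) hFop).
- by move=> X Y X' i f; apply: (rfl_pushout hD hF).
- by move=> X Y X' i f; apply: (rfl_pushout (op_exact hD) hFop).
Qed.

End Transport.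

(** * Monomorphisms in an abelian category *)

Section Abelian.
Variables (k : fieldType) (C : linCat k) (hC : is_abelian C).

(** A monomorphism [i] is a kernel of some [q]; as [q] factors through [p], every morphism killed by
    [p] is killed by [q] and lifts to [X]. *)
Lemma abelian_mono_kernel (X Y Z : C) (i : mor X Y) (p : mor Y Z) :
  is_mono i -> is_cokernel i p -> is_kernel i p.
Proof.
move=> mi cp; have [_ _ _ /(_ _ _ i mi)[Q [q kq]] _] := hC.
have [q' q'E] := coker_lift cp (proj1 kq).
apply: is_kernelI; first exact: (proj1 cp).
  by move=> W g; apply: (ker_mono0 kq).
by move=> W f pf; apply: (ker_lift kq); rewrite -q'E -compA pf compm0.
Qed.

(** [f] is a kernel of some [q], and [q = 0] because [f] is epi, so the identity of [Y] lifts
    through [f]. *)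
Lemma abelian_mono_epi_iso (X Y : C) (f : mor X Y) :
  is_mono f -> is_epi f -> is_iso f.
Proof.
move=> mf ef; have [_ _ _ /(_ _ _ f mf)[Q [q kq]] _] := hC.
have q0 : q = 0 by apply: ef; rewrite (proj1 kq) comp0m.
have [|g fg] := ker_lift (f := idm Y) kq; first by rewrite q0 comp0m.
by exists g; split=> //; apply: mf; rewrite compA fg comp1m compm1.
Qed.

End Abelian.

(** * Functors into full subcategories and out of ideal quotients *)

Section FunctorConstructions.
Variable k : fieldType.

Definition full_lift (C : linCat k) (D : seqCat k) (S : D -> Prop)
    (F : functor C D) (FS : forall X, S (F X)) : functor C (full S) :=
  @Functor k C (full S) (fun X => exist S (F X) (FS X))
    (fun X Y f => fmap F f) (@fmap_linear _ _ _ F) (fmap1 F)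
    (fun X Y Z g f => fmapM F g f).

Section QuotLift.
Variables (C : seqCat k) (A : C -> Prop) (D : linCat k) (F : functor C D).
Hypothesis FA : forall X, A X -> idm (F X) = 0.

Lemma fmap_factor_ideal (X Y : C) (f : mor X Y) :
  factor_ideal A f -> fmap F f = 0.
Proof.
move=> [n [W [h [g [AW ->]]]]]; rewrite fmap_sum big1 // => i _.
by rewrite fmapM -[fmap F (g i)]comp1m FA // comp0m compm0.
Qed.

Definition quot_lift_map (X Y : quot A) (f : mor X Y) : mor (F X) (F Y) :=
  fmap F (generic_quotient.repr f).

(** Two representatives differ by a morphism in the ideal, which [F] kills because it sends the
    objects of [A] to zero objects. *)
Lemma quot_lift_pi (X Y : C) (f : mor X Y) :
  quot_lift_map (fmap (quot_functor A) f) = fmap F f.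
Proof.
apply/subr0_eq; rewrite -fmapB.
by apply/fmap_factor_ideal/quot_piE; apply: quot_reprK.
Qed.

Lemma quot_functor_full : is_full (quot_functor A).
Proof.
by move=> X Y g; exists (generic_quotient.repr g); apply: quot_reprK.
Qed.

Definition quot_lift : functor (quot A) D.
Proof.
apply: (@Functor k (quot A) D F quot_lift_map).
- move=> X Y a f g.
  have [f' <-] := quot_functor_full f; have [g' <-] := quot_functor_full g.
  by rewrite -(fmap_linear (quot_functor A)) !quot_lift_pi fmap_linear.
- by move=> X; rewrite -(fmap1 (quot_functor A)) quot_lift_pi fmap1.
move=> X Y Z g f.
have [f' <-] := quot_functor_full f; have [g' <-] := quot_functor_full g.
by rewrite -(fmapM (quot_functor A)) !quot_lift_pi fmapM.
Defined.

End QuotLift.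

End FunctorConstructions.

(** * A criterion for equivalences of exact categories *)

Section ExactEquivalence.
Variables (k : fieldType) (C D : seqCat k) (F : functor C D).
Hypotheses (hD : is_exact D) (ful : is_full F) (fth : is_faithful F).
Hypothesis ess : ess_surjective F.
Hypothesis Fses : forall (X Y Z : C) (i : mor X Y) (p : mor Y Z),
  ses i p <-> ses (fmap F i) (fmap F p).

Let hF : reflects_exact F.
Proof. by split=> // *; apply: ess. Qed.

Let Finj X Y := @faithful_inj _ _ _ F X Y fth.

Lemma fmap_ext_morph (eF : is_exact_functor F) (Z X Z' X' : C) (a : mor X X')
    (c : mor Z Z') (e : extension Z X) (e' : extension Z' X') :
  ext_morph a c e e' ->
  ext_morph (fmap F a) (fmap F c) (ext_map eF e) (ext_map eF e').
Proof. by move=> [b [bi pb]]; exists (fmap F b); rewrite -!fmapM bi pb. Qed.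

Lemma fmap_biprod (X Y W : C) (s1 : mor X W) (s2 : mor Y W) (r1 : mor W X)
    (r2 : mor W Y) :
  is_biprod s1 s2 r1 r2 ->
  is_biprod (fmap F s1) (fmap F s2) (fmap F r1) (fmap F r2).
Proof.
move=> [rs11 rs22 rs12 rs21 sr]; split; rewrite -!fmapM.
- by rewrite rs11 fmap1.
- by rewrite rs22 fmap1.
- by rewrite rs12 fmap0.
- by rewrite rs21 fmap0.
by rewrite -fmapD sr fmap1.
Qed.

(** On Ext^1, injectivity comes from lifting isomorphisms of middle terms and surjectivity from
    [rfl_lift]; Baer sums and scalar multiples are witnessed by diagrams that [F] preserves. *)
Lemma ff_exact_equivalence : is_exact_equivalence F.
Proof.
have eF : is_exact_functor F by move=> X Y Z i p /Fses.
split=> //; first exact: reflects_exact_exact hF.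
  exact: ff_equivalence.
exists eF => Z X; split.
- move=> e e' [b0 [ib0 bi pb]]; have [b bE] := ful b0; exists b; split.
  + by apply: (ff_iso ful fth); rewrite bE.
  + by apply: Finj; rewrite fmapM bE.
  by apply: Finj; rewrite fmapM bE.
- case=> Y i p sip.
  have [Y' [b [b' [i0 [p0 [[b'b bb'] sip0 i0E p0E]]]]]] := rfl_lift hD hF sip.
  exists (Extension sip0), b; split=> /=; first by exists b'.
  + by rewrite i0E compA bb' comp1m.
  by rewrite p0E.
- move=> e1 e2 e [XX [ZZ [s1 [s2 [r1 [r2 [t1 [t2 [q1 [q2 [e12 [e']]]]]]]]]]]].
  move=> [[bX bZ m1 m2] m12 m]; exists (F XX), (F ZZ), (fmap F s1), (fmap F s2).
  exists (fmap F r1), (fmap F r2), (fmap F t1), (fmap F t2), (fmap F q1).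
  exists (fmap F q2), (ext_map eF e12), (ext_map eF e'); split.
  + by split; [exact: fmap_biprod | exact: fmap_biprod
      | exact: fmap_ext_morph | exact: fmap_ext_morph].
  + by rewrite -fmap1 -fmapD; apply: fmap_ext_morph.
  by rewrite -fmap1 -fmapD; apply: fmap_ext_morph.
move=> a e e' m; rewrite /ext_scale -!fmap1 -fmapZ.
exact: fmap_ext_morph.
Qed.

End ExactEquivalence.

(** * Sub U and finite families of morphisms to U *)

Section JointMono.
Variables (k : fieldType) (D : seqCat k) (U : D).

(** Amounts to a monomorphism from [X] to a finite power of [U], without the choice of a direct
    sum. *)
Definition joint_mono (X : D) (s : seq (mor X U)) : Prop :=
  forall W (g : mor W X), (forall m, m \in s -> m ∘ g = 0) -> g = 0.

(** Induction on [in_Sub]: families are composed with the projections of a direct sum and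
    concatenated, and restricted along an inflation. *)
Lemma in_Sub_joint_mono (X : D) :
  (forall (X Y Z : D) (i : mor X Y) (p : mor Y Z), ses i p -> is_kernel i p) ->
  in_Sub U X -> exists s : seq (mor X U), joint_mono s.
Proof.
move=> ker; elim=> [|n Y W _ IH [s [r [_ _ sr]]]|Y Z i [Q [q sq]] _ [s sP]].
- exists [:: idm U] => W g /(_ (idm U)); rewrite comp1m; apply.
  exact: mem_head.
- pose t i := projT1 (cid (IH i)).
  exists (flatten [seq [seq m ∘ r i | m <- t i] | i <- enum 'I_n]) => V g g0.
  rewrite -[g]comp1m -sr comp_suml big1 // => i _.
  rewrite -compA (_ : r i ∘ g = 0) ?compm0 //.
  apply: (projT2 (cid (IH i))) => m mt; rewrite compA; apply: g0.
  apply/flatten_mapP; exists i; first by rewrite mem_enum.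
  by apply/mapP; exists m.
exists [seq m ∘ i | m <- s] => W g g0; apply: (ker_mono0 (ker _ _ _ _ _ sq)).
apply: sP => m ms; rewrite compA; apply: g0.
by apply/mapP; exists m.
Qed.

(** The family assembles into one monomorphism to a power of [U], which is an inflation by
    assumption. *)
Lemma joint_mono_in_Sub (X : D) (s : seq (mor X U)) :
  is_additive D ->
  (forall (X Y : D) (i : mor X Y), is_mono i -> inflation i) ->
  joint_mono s -> in_Sub U X.
Proof.
move=> add infl sP.
have [W Wsum] := add (size s) (fun=> U); have [t [r [rt rt0 _]]] := Wsum.
pose f := \sum_(i < size s) t i ∘ nth 0 s i.
have rf i : r i ∘ f = nth 0 s i.
  rewrite /f comp_sumr (bigD1 i) //= big1 ?addr0 => [|j ji].
    by rewrite compA rt comp1m.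
  by rewrite compA rt0 ?comp0m // eq_sym.
apply: (Sub_subobj (i := f)); last by apply: Sub_dirsum Wsum => _; constructor.
apply: infl => V g g' eqg; apply/subr0_eq/sP => m /(nthP 0)[i si <-].
by rewrite -[nth _ _ _](rf (Ordinal si)) -compA compBr eqg subrr compm0.
Qed.

End JointMono.

(** * Torsion pairs and the torsion-free quotient functor *)

Section TorsionPair.
Variables (k : fieldType) (E : seqCat k) (hE : is_exact E).
Variables (T F : E -> Prop) (hTF : torsion_pair T F).

(** The torsion part of [X] includes by zero, so the deflation onto the torsion-free quotient is
    invertible. *)
Lemma torsionfree_iso (X : E) :
  (forall W (f : mor W X), T W -> f = 0) ->
  exists Y (b : mor X Y), F Y /\ is_iso b.
Proof.
move=> X0; have [T0 [Y [i [p [TT0 FY sip]]]]] := proj2 hTF X.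
exists Y, p; split=> //; have cp := ses_cokernel hE sip.
have [|g gp] := coker_lift (f := idm X) cp; first by rewrite (X0 _ i) ?compm0.
by exists g; split=> //; apply: (coker_epi cp); rewrite -compA gp comp1m compm1.
Qed.

Definition torsion_sequence (X : E) :
  {T0 : E & {Y : E & {i : mor T0 X &
    {p : mor X Y | [/\ T T0, F Y & ses i p]}}}}.
Proof.
have /cid[T0 /cid[Y /cid[i /cid[p h]]]] := proj2 hTF X.
by exists T0, Y, i, p.
Qed.

Definition tors (X : E) : E := projT1 (torsion_sequence X).
Definition tfree (X : E) : E := projT1 (projT2 (torsion_sequence X)).
Definition tors_inc (X : E) : mor (tors X) X :=
  projT1 (projT2 (projT2 (torsion_sequence X))).
Definition tfree_pi (X : E) : mor X (tfree X) :=
  sval (projT2 (projT2 (projT2 (torsion_sequence X)))).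

Lemma torsP (X : E) : T (tors X).
Proof. by case: (svalP (projT2 (projT2 (projT2 (torsion_sequence X))))). Qed.

Lemma tfreeP (X : E) : F (tfree X).
Proof. by case: (svalP (projT2 (projT2 (projT2 (torsion_sequence X))))). Qed.

Lemma tors_ses (X : E) : ses (tors_inc X) (tfree_pi X).
Proof. by case: (svalP (projT2 (projT2 (projT2 (torsion_sequence X))))). Qed.

Lemma tfree_pi_epi (X : E) : is_epi (tfree_pi X).
Proof. exact: (coker_epi (ses_cokernel hE (tors_ses X))). Qed.

Lemma tfree_factor (X Y : E) (f : mor X Y) :
  F Y -> exists g, g ∘ tfree_pi X = f.
Proof.
move=> FY; apply: (coker_lift (ses_cokernel hE (tors_ses X))).
by apply: (proj1 hTF) => //; apply: torsP.
Qed.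

Lemma tors_factor (X Y : E) (f : mor X Y) :
  T X -> exists g, tors_inc Y ∘ g = f.
Proof.
move=> TX; apply: (ker_lift (ses_kernel hE (tors_ses Y))).
by apply: (proj1 hTF) => //; apply: tfreeP.
Qed.

Definition tfree_map (X Y : E) (f : mor X Y) : mor (tfree X) (tfree Y) :=
  projT1 (cid (tfree_factor (tfree_pi Y ∘ f) (tfreeP Y))).

Lemma tfree_mapE (X Y : E) (f : mor X Y) :
  tfree_map f ∘ tfree_pi X = tfree_pi Y ∘ f.
Proof. exact: projT2 (cid (tfree_factor (tfree_pi Y ∘ f) (tfreeP Y))). Qed.

Lemma tfree_mapM (X Y Z : E) (g : mor Y Z) (f : mor X Y) :
  tfree_map (g ∘ f) = tfree_map g ∘ tfree_map f.
Proof.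
by apply: tfree_pi_epi; rewrite -compA !tfree_mapE !compA tfree_mapE.
Qed.

Definition tfree_functor : functor E (full F).
Proof.
apply: (@Functor k E (full F) (fun X => exist F (tfree X) (tfreeP X))
  tfree_map).
- move=> X Y a f g; apply: tfree_pi_epi.
  by rewrite /= compDl compZl !tfree_mapE comp_linearr.
- by move=> X; apply: tfree_pi_epi; rewrite tfree_mapE compm1 comp1m.
exact: tfree_mapM.
Defined.

(** The bijection is composition with the unit [tfree_pi]; its inverse is the factorization given by
    [tfree_factor]. *)
Lemma tfree_left_adjoint : is_left_adjoint tfree_functor (full_incl F).
Proof.
exists (fun X (Y : full F) (g : mor (tfree X) (sval Y)) => g ∘ tfree_pi X).
split=> [X Y|X' X Y f g|X Y Y' h g].
- exists (fun f => projT1 (cid (tfree_factor f (svalP Y)))) => [g|f].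
    apply: tfree_pi_epi.
    exact: projT2 (cid (tfree_factor (g ∘ tfree_pi X) (svalP Y))).
  exact: projT2 (cid (tfree_factor f (svalP Y))).
- by rewrite -!compA tfree_mapE.
by rewrite -compA.
Qed.

(* A sequence 0 -> T0 -> X -> V -> 0 with V torsion-free and T0 only
   left-orthogonal to F still computes the torsion-free quotient. *)
Lemma tfree_iso (X V T0 : E) (i : mor T0 X) (p : mor X V) :
  ses i p -> F V -> (forall Y (f : mor T0 Y), F Y -> f = 0) ->
  exists b : mor (tfree X) V, is_iso b.
Proof.
move=> sip FV T00; have cp := ses_cokernel hE sip.
have [b bE] := tfree_factor p FV.
have [c cE] := coker_lift (f := tfree_pi X) cp (T00 _ _ (tfreeP X)).
exists b, c; split; first by apply: tfree_pi_epi; rewrite -compA bE cE comp1m.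
by apply: (coker_epi cp); rewrite -compA cE bE comp1m.
Qed.

End TorsionPair.

(** * Direct sums and summands of powers of an object *)

(** The maps of P^n are composed with those of the summand [X]. In this form, free of direct sums,
    the torsion parts are handled below. *)
Lemma in_add_sum (k : fieldType) (E : linCat k) (P X : E) :
  in_add P X -> exists n (a : 'I_n -> mor X P) (b : 'I_n -> mor P X),
    \sum_j b j ∘ a j = idm X.
Proof.
move=> [n [W [Y [s1 [s2 [r1 [r2 [[s [r [_ _ sr]]] [rs _ _ _ _]]]]]]]]].
exists n, (fun j => r j ∘ s1), (fun j => r1 ∘ s j).
transitivity (r1 ∘ (\sum_j s j ∘ r j) ∘ s1); last by rewrite sr compm1.
by rewrite comp_sumr comp_suml; apply: eq_bigr => j _; rewrite !compA.
Qed.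

Lemma in_add_self (k : fieldType) (E : linCat k) (P : E) :
  is_additive E -> in_add P P.
Proof.
move=> add; have [Z Zsum] := add _ (fun _ : 'I_0 => P).
have Z0 : idm Z = 0 by case: Zsum => s [r [_ _ <-]]; rewrite big_ord0.
exists 1%N, P, Z, (idm P), 0, (idm P), 0; split; last first.
  by split; rewrite ?compm0 ?comp0m ?addr0 ?comp1m ?Z0.
exists (fun=> idm P), (fun=> idm P).
split=> [_|j j'|]; first exact: comp1m.
  by rewrite !ord1.
by rewrite big_ord_recl big_ord0 addr0 comp1m.
Qed.

Lemma dirsum_iso (k : fieldType) (C : linCat k) n (X : 'I_n -> C) (V W : C) :
  is_dirsum X V -> is_dirsum X W -> exists b : mor V W, is_iso b.
Proof.
move=> [s [r [rs rs0 sr]]] [s' [r' [rs' rs0' sr']]].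
have E (Y Z : C) (t : forall i, mor (X i) Y) (u : forall i, mor Z (X i)) t' u' :
    (forall i, u' i ∘ t i = idm (X i)) ->
    (forall i j, i != j -> u' i ∘ t j = 0) ->
    (\sum_i t' i ∘ u' i) ∘ (\sum_i t i ∘ u i) = \sum_i (t' i : mor _ Z) ∘ u i.
  move=> ut ut0; rewrite comp_suml; apply: eq_bigr => i _.
  rewrite comp_sumr (bigD1 i) //= big1 => [|j ji].
    by rewrite addr0 compA -(compA (t' i)) ut compm1.
  by rewrite compA -(compA (t' i)) ut0 1?eq_sym // compm0 comp0m.
exists (\sum_i s' i ∘ r i), (\sum_i s i ∘ r' i).
by rewrite !E.
Qed.

(** * Vanishing results for B, C and U *)

Section Main.
Variables (k : fieldType) (E : seqCat k) (hE : is_exact E).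
Variables (A B C : E -> Prop).
Hypotheses (hAB : torsion_pair A B) (hBC : torsion_pair B C).
Hypothesis hproj : enough_projectives E.
Hypothesis hprojC : forall Q : E, projective Q -> C Q.
Variables (P : E) (hP : projective P) (hPC : injective_in C P).
Hypothesis hA : forall X : E, A X <-> in_add P X.
Hypothesis hB : abelian_compatible B.
Variables (CP : E) (U : full B) (i : mor P CP) (p : mor CP (full_incl B U)).
Hypothesis hU : is_U_sequence C i p.

Let sip : ses i p. Proof. by case: hU. Qed.
Let CCP : C CP. Proof. by case: hU. Qed.
Let vCP : ext1_vanish B CP. Proof. by case: hU. Qed.

(* The closure of C under isomorphism. *)
Definition Bperp (X : E) : Prop := forall W (f : mor W X), B W -> f = 0.

Lemma C_Bperp (X : E) : C X -> Bperp X.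
Proof. by move=> CX W f BW; apply: (proj1 hBC). Qed.

Lemma Bperp_iso (X : E) : Bperp X -> exists Y (b : mor X Y), C Y /\ is_iso b.
Proof. by move=> cX; apply: (torsionfree_iso hE hBC) => W f; apply: cX. Qed.

Lemma Bperp_ext (X Y Z : E) (j : mor X Y) (q : mor Y Z) :
  ses j q -> Bperp X -> Bperp Z -> Bperp Y.
Proof.
move=> sjq cX cZ W f BW.
have [g <-] := ker_lift (ses_kernel hE sjq) (cZ W (q ∘ f) BW).
by rewrite (cX W g BW) compm0.
Qed.

Lemma Bperp_ext1 (X T : E) : Bperp X -> ext1_vanish C T -> ext1_vanish (eq X) T.
Proof.
move=> /Bperp_iso[Y [b [CY ib]]] vT.
exact: (ext1_vanish_iso hE vT CY ib).
Qed.

Lemma tors_sum (X : E) : exists n (a : 'I_n -> mor (tors hAB X) P)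
  (b : 'I_n -> mor P (tors hAB X)), \sum_j b j ∘ a j = idm (tors hAB X).
Proof. exact: in_add_sum (proj1 (hA _) (torsP hAB X)). Qed.

Lemma tors_projective (X : E) : projective (tors hAB X).
Proof.
have [n [a [b ba]]] := tors_sum X => Y Z q f dq.
have /choice[g gE] : forall j, exists g, q ∘ g = f ∘ b j by move=> j; apply: hP.
exists (\sum_j g j ∘ a j); rewrite comp_sumr -[RHS]compm1 -ba comp_sumr.
by apply: eq_bigr => j _; rewrite !compA gE.
Qed.

(** [tors hAB Y] is a retract of a power of [P], which is injective in [C]. *)
Lemma tors_ext1 (X Y : E) : Bperp X -> ext1_vanish (eq X) (tors hAB Y).
Proof.
move=> cX; apply: Bperp_ext1 => //; have [n [a [b ba]]] := tors_sum Y.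
exact: (ext1_vanish_retract hE (proj2 hPC) ba).
Qed.

(** [K] embeds in [Q], which lies in [C], so it receives only zero morphisms from [B]. This
    presentation serves the dimension shift from Ext^2(Z, P) to Ext^1(K, P). *)
Lemma projective_deflation (Z : E) : exists K Q (j : mor K Q) (q : mor Q Z),
  [/\ ses j q, projective Q & Bperp K].
Proof.
have [Q [q [pQ [K [j sjq]]]]] := hproj Z; exists K, Q, j, q; split=> // W f BW.
apply: (ker_mono0 (ses_kernel hE sjq)).
exact: (C_Bperp (hprojC pQ)).
Qed.

(** For an extension [W] of [Z] by [U], the map [l] from [Q] to [W] restricts to [u] from [K] to
    [U]. It lifts to [CP] because Ext^1(K, P) = 0, and the lift extends to [Q] because Ext^1(Z, CP)
    = 0. *)
Lemma U_ext1 : ext1_vanish B (sval U).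
Proof.
move=> Z BZ [W iU pW siW].
have [K [Q [j [q [sjq pQ cK]]]]] := projective_deflation Z.
have [l lE] : exists l : mor Q W, pW ∘ l = q by apply: pQ; exists (sval U), iU.
have [u uE] : exists u, iU ∘ u = l ∘ j.
  apply: (ker_lift (ses_kernel hE siW)).
  by rewrite compA lE (ses_comp0 hE sjq).
have [g gE] := ext1_vanish_lift hE u (Bperp_ext1 cK (proj2 hPC)) (erefl K) sip.
have [h hj] := ext1_vanish_extend hE g vCP BZ sjq.
(* Subtracting the extended lift makes [l] vanish on [K], so that it descends to a section of
   [pW]. *)
have [s sE] : exists s, s ∘ q = l - iU ∘ (p ∘ h).
  apply: (coker_lift (ses_cokernel hE sjq)).
  by rewrite compBl -!compA hj gE uE subrr.
exists s; apply: (coker_epi (ses_cokernel hE sjq)) => /=.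
by rewrite -compA sE compBr compA (ses_comp0 hE siW) comp0m subr0 lE comp1m.
Qed.

(* The pullback of the sequence along g splits, so that g lifts to a morphism
   from B to X, which is zero. *)
Lemma Bperp_split_zero (T X V W : E) (j : mor T X) (q : mor X V) (g : mor W V) :
  ses j q -> Bperp X -> B W ->
  (forall W' (q' : mor W' W) (g' : mor W' X) (j' : mor T W'), ses j' q' ->
     g' ∘ j' = j -> q ∘ g' = g ∘ q' -> exists r, r ∘ j' = idm T) ->
  g = 0.
Proof.
move=> sjq cX BW split_j.
have [W' [q' [g' [j' [sj'q' [qg' _] g'j']]]]] := pullback_ses hE g sjq.
have [r rj'] := split_j _ _ _ _ sj'q' g'j' qg'.
have [s [q's _]] := ses_retract hE sj'q' rj'.
by rewrite -[g]compm1 -q's compA -qg' -compA (cX _ (g' ∘ s) BW) compm0.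
Qed.

(** * Cogeneration by U and torsion-free quotients of objects of C *)

(** This is [joint_mono] in [full B], phrased in [E] to keep membership proofs out of the types. *)
Definition U_cogenerated (V : E) : Prop :=
  exists s : seq (mor V (sval U)), forall W (g : mor W V), B W ->
    (forall m, m \in s -> m ∘ g = 0) -> g = 0.

Lemma tfree_cogenerated (X : E) : Bperp X -> U_cogenerated (tfree hAB X).
Proof.
move=> cX; have sX := tors_ses hAB X; have [n [a [b ba]]] := tors_sum X.
have BX : B (tfree hAB X) := tfreeP hAB X.
have /choice[c cE] : forall j, exists c, c ∘ tors_inc hAB X = i ∘ a j.
  by move=> j; apply: (ext1_vanish_extend hE (i ∘ a j) vCP BX sX).
have /choice[u uE] : forall j, exists u, u ∘ tfree_pi hAB X = p ∘ c j.
  move=> j; apply: (coker_lift (ses_cokernel hE sX)).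
  by rewrite -compA cE compA (ses_comp0 hE sip) comp0m.
exists (codom u) => W g BW g0; apply: (Bperp_split_zero sX cX BW).
move=> W' q' g' j' sj'q' g'j' gq'.
have /choice[h eqh] : forall j, exists h, i ∘ h = c j ∘ g'.
  move=> j; apply: (ker_lift (ses_kernel hE sip)).
  by rewrite compA -uE -compA gq' compA g0 ?comp0m // codom_f.
(* This retracts [j']: both [h j ∘ j'] and [a j] become [c j ∘ tors_inc hAB X] after composition
   with the monomorphism [i]. *)
exists (\sum_j b j ∘ h j); rewrite comp_suml -ba; apply: eq_bigr => j _.
rewrite -compA; congr (_ ∘ _); apply: (ker_mono (ses_kernel hE sip)).
by rewrite compA eqh -compA g'j' cE.
Qed.

(** Ext^1(X, tY) = 0 lifts [g ∘ tfree_pi hAB X] to a morphism into [Y]. *)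
Lemma tfree_full (X Y : E) (g : mor (tfree hAB X) (tfree hAB Y)) :
  Bperp X -> exists f : mor X Y, tfree_map hE hAB f = g.
Proof.
move=> cX; have [f fE] := ext1_vanish_lift hE (g ∘ tfree_pi hAB X)
  (tors_ext1 (Y := Y) cX) (erefl X) (tors_ses hAB Y).
by exists f; apply: (tfree_pi_epi hE); rewrite tfree_mapE.
Qed.

Lemma tfree_faithful (X Y : E) (f : mor X Y) :
  tfree_map hE hAB f = 0 -> exists h, tors_inc hAB Y ∘ h = f.
Proof.
move=> f0; apply: (ker_lift (ses_kernel hE (tors_ses hAB Y))).
by rewrite -tfree_mapE f0 comp0m.
Qed.

(* Iterated pullback of the sequence of U along the morphisms of s. *)
Lemma lift_to_CP (V : E) (s : seq (mor V (sval U))) :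
  exists T X (j : mor T X) (q : mor X V),
    [/\ ses j q, Bperp T, forall Y (f : mor T Y), B Y -> f = 0
      & forall m, m \in s -> exists c, p ∘ c = m ∘ q].
Proof.
elim: s => [|m s [T [X [j [q [sjq cT T0 sq]]]]]].
  have [T [j sj]] := deflation1 hE V.
  have T0 : idm T = 0.
    apply: (ker_mono0 (ses_kernel hE sj)).
    by rewrite compm1 -[j]comp1m (ses_comp0 hE sj).
  exists T, V, j, (idm V); split=> // [W f _|Y f _].
    by rewrite -[f]comp1m T0 comp0m.
  by rewrite -[f]compm1 T0 compm0.
have [X' [q' [c [i' [si'q' [pc _] _]]]]] := pullback_ses hE (m ∘ q) sip.
have [T' [j' [u [v [sj' sv _ _]]]]] := deflation_comp_ses hE sjq si'q'.
exists T', X', j', (q ∘ q'); split=> //.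
- exact: (Bperp_ext sv (C_Bperp (proj1 hPC)) cT).
- move=> Y f BY; have [|g <-] := coker_lift (f := f) (ses_cokernel hE sv).
    apply: (proj1 hAB) => //; apply/hA.
    exact: (in_add_self P (exact_additive hE)).
  by rewrite (T0 _ g BY) comp0m.
move=> n; rewrite inE => /orP[/eqP->|/sq[d dE]].
  by exists c; rewrite pc compA.
by exists (d ∘ q'); rewrite compA dE compA.
Qed.

(** A morphism from [B] to the lifted object [X] dies in [V], since its composite with each member
    of [s] factors through [CP], which receives only zero from [B]. It then lands in [T], where it
    is zero as well, so [X] is isomorphic to an object of [C]. *)
Lemma cogenerated_tfree (V : E) :
  B V -> U_cogenerated V ->
  exists X (b : mor (tfree hAB X) V), C X /\ is_iso b.
Proof.
move=> BV [s sP]; have [T [X [j [q [sjq cT T0 sq]]]]] := lift_to_CP s.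
have cX : Bperp X.
  move=> W f BW; have qf : q ∘ f = 0.
    apply: sP => // m /sq[c cE].
    by rewrite compA -cE -compA (C_Bperp CCP (c ∘ f) BW) compm0.
  have [g <-] := ker_lift (ses_kernel hE sjq) qf.
  by rewrite (cT _ g BW) compm0.
have [Y [b [CY /isoV[b' [b'b bb' _]]]]] := Bperp_iso cX; exists Y.
have sjq' := ses_iso_mid hE sjq b'b bb'.
by have [c ic] := tfree_iso hE hAB sjq' BV T0; exists c.
Qed.

(** * Exactness of the torsion-free quotient *)

(** An abelian category is balanced; the last two hypotheses say mono and epi in [full B]. *)
Lemma B_iso (X Y : E) (f : mor X Y) :
  B X -> B Y -> (forall W (g : mor W X), B W -> f ∘ g = 0 -> g = 0) ->
  (forall W (g : mor Y W), B W -> g ∘ f = 0 -> g = 0) -> is_iso f.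
Proof.
move=> BX BY mf ef.
apply: (abelian_mono_epi_iso (proj1 hB)
  (X := exist B X BX) (Y := exist B Y BY)).
  move=> W g g' eqg; apply/subr0_eq/(mf _ _ (svalP W)).
  by rewrite compBr [X in X - _]eqg subrr.
move=> W g g' eqg; apply/subr0_eq/(ef _ _ (svalP W)).
by rewrite compBl [X in X - _]eqg subrr.
Qed.

(** As tZ is projective, its inclusion lifts to [s] from tZ to [Y]. Correcting the inclusion of tY
    by [s] gives [r] from tY to tX, which turns the map [h] into tY, provided by the vanishing of
    the composite with [g], into the retraction that [Bperp_split_zero] asks for. *)
Lemma tfree_mono (X Y Z W : E) (f : mor X Y) (q : mor Y Z)
    (g : mor W (tfree hAB X)) :
  ses f q -> Bperp X -> B W -> tfree_map hE hAB f ∘ g = 0 -> g = 0.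
Proof.
move=> sfq cX BW fg0.
have kf := ses_kernel hE sfq.
have [u uE] := tors_factor hE hAB (q ∘ tors_inc hAB Y) (torsP hAB Y).
have [s sE] : exists s, q ∘ s = tors_inc hAB Z.
  by apply: tors_projective; exists X, f.
have [d dE] : exists d, f ∘ d = tors_inc hAB Y - s ∘ u.
  by apply: (ker_lift kf); rewrite compBr compA sE uE subrr.
have [r rE] := tors_factor hE hAB d (torsP hAB Y).
apply: (Bperp_split_zero (tors_ses hAB X) cX BW).
move=> W' q' g' j' sj'q' g'j' gq'.
have [h eqh] : exists h, tors_inc hAB Y ∘ h = f ∘ g'.
  apply: (ker_lift (ses_kernel hE (tors_ses hAB Y))).
  by rewrite compA -(tfree_mapE hE) -compA gq' compA fg0 comp0m.
have uh0 : u ∘ h ∘ j' = 0.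
  apply: (ker_mono0 (ses_kernel hE (tors_ses hAB Z))).
  by rewrite !compA uE -(compA q) eqh !compA (ses_comp0 hE sfq) !comp0m.
exists (r ∘ h); apply: (ker_mono (ses_kernel hE (tors_ses hAB X))).
apply: (ker_mono kf); rewrite compm1 !compA -(compA f) rE dE !compBl.
by rewrite -!(compA s) uh0 compm0 subr0 eqh -compA g'j'.
Qed.

(** The torsion-free quotient preserves cokernels, as left adjoints do, and [tfree_mono] makes the
    first map a monomorphism in [full B]; compatibility then gives a short exact sequence of [E]. *)
Lemma tfree_exact (X Y Z : E) (f : mor X Y) (q : mor Y Z) :
  ses f q -> Bperp X -> ses (tfree_map hE hAB f) (tfree_map hE hAB q).
Proof.
move=> sfq cX; have cq := ses_cokernel hE sfq.
pose L : functor E (full B) := tfree_functor hE hAB.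
have cLq : is_cokernel (fmap L f) (fmap L q).
  apply: is_cokernelI => [|W g gq|W g gf].
  - by rewrite -fmapM (proj1 cq) fmap0.
  - apply: (tfree_pi_epi hE); apply: (coker_epi cq).
    by rewrite -compA -tfree_mapE compA [X in X ∘ _]gq !comp0m.
  have [|h hq] := coker_lift 
      (f := (g : mor (tfree hAB Y) (sval W)) ∘ tfree_pi hAB Y) cq.
    by rewrite -compA -(tfree_mapE hE) compA [X in X ∘ _]gf comp0m.
  have [h' h'E] := tfree_factor hE hAB h (svalP W).
  exists h'; apply: (tfree_pi_epi hE).
  by rewrite -hq -h'E -!compA -(tfree_mapE hE).
apply/(proj2 hB (L X) (L Y) (L Z)); split=> //.
apply: (abelian_mono_kernel (proj1 hB)) cLq => W g g' eqg.
apply/subr0_eq/(tfree_mono sfq cX (svalP W)).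
by rewrite compBr [X in X - _]eqg subrr.
Qed.

(* For 0 -> K -> Q -> Z -> 0 with Q projective, Q -> Z -> L Z lifts to V, the
   induced K -> L X lifts to X because Ext^1(K, P) = 0, and Y is the pushout of
   K -> Q along K -> X. *)
Lemma tfree_ext_lift (X Z V : E) (f' : mor (tfree hAB X) V)
    (q' : mor V (tfree hAB Z)) :
  ses f' q' -> Bperp X -> Bperp Z -> B V ->
  exists Y (f : mor X Y) (q : mor Y Z) (b : mor (tfree hAB Y) V),
    [/\ ses f q, Bperp Y, is_iso b, b ∘ tfree_map hE hAB f = f'
      & q' ∘ b = tfree_map hE hAB q].
Proof.
move=> sf'q' cX cZ BV.
have [K [Q [j [c [sjc pQ cK]]]]] := projective_deflation Z.
have [l lE] : exists l, q' ∘ l = tfree_pi hAB Z ∘ c.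
  by apply: pQ; exists (tfree hAB X), f'.
have [u uE] : exists u, f' ∘ u = l ∘ j.
  apply: (ker_lift (ses_kernel hE sf'q')).
  by rewrite compA lE -compA (ses_comp0 hE sjc) compm0.
have [v vE] := ext1_vanish_lift hE u (tors_ext1 (Y := X) cK) (erefl K)
  (tors_ses hAB X).
have [Y [f [w [q [sfq [wj po] qw]]]]] := pushout_ses hE v sjc.
have [m [[mw mf] _]] : exists! m, m ∘ w = l /\ m ∘ f = f' ∘ tfree_pi hAB X.
  by apply: po; rewrite -compA vE uE.
(* Both sides agree with [q' ∘ l] on [Q] and vanish on [X], so the pushout property identifies
   them. *)
have q'm : q' ∘ m = tfree_pi hAB Z ∘ q.
  have [|n [_ nU]] := po _ (q' ∘ l) 0.
    by rewrite lE -compA (ses_comp0 hE sjc) compm0 comp0m.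
  transitivity n; [symmetry|]; apply: nU; rewrite -!compA.
    by rewrite mw mf compA (ses_comp0 hE sf'q') comp0m.
  by rewrite qw (ses_comp0 hE sfq) compm0 lE.
have [b bE] := tfree_factor hE hAB m BV.
have bf : b ∘ tfree_map hE hAB f = f'.
  by apply: (tfree_pi_epi hE); rewrite -compA tfree_mapE compA bE.
have q'b : q' ∘ b = tfree_map hE hAB q.
  by apply: (tfree_pi_epi hE); rewrite -compA bE tfree_mapE.
have sL := tfree_exact sfq cX.
exists Y, f, q, b; split=> //; first exact: Bperp_ext sfq cX cZ.
(* Short five lemma: [b] is compatible with the identities of both end terms. *)
apply: (B_iso (tfreeP hAB Y) BV) => W g BW g0.
  have [|h eqh] := ker_lift (f := g) (ses_kernel hE sL).
    by rewrite -q'b -compA g0 compm0.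
  rewrite -eqh (ker_mono0 (ses_kernel hE sf'q') (g := h)) ?compm0 //.
  by rewrite -bf -compA eqh.
have [|h eqh] := coker_lift (f := g) (ses_cokernel hE sf'q').
  by rewrite -bf compA g0 comp0m.
rewrite -eqh (coker_epi0 (ses_cokernel hE sL) (g := h)) ?comp0m //.
by rewrite -q'b compA eqh.
Qed.

(** * The exact structure of Sub U *)

Lemma B_mono_inflation (X Y : full B) (f : mor X Y) : is_mono f -> inflation f.
Proof.
move=> mf; have [_ _ /(_ _ _ f)[Z [q cq]] _ _] := proj1 hB.
exists Z, q; apply/(proj2 hB); split=> //.
exact: (abelian_mono_kernel (proj1 hB)).
Qed.

(** Turns the inductive [in_Sub] into a condition on morphisms to [U], suited to arguments in
    [E]. *)
Lemma Sub_cogenerated (X : full B) : in_Sub U X <-> U_cogenerated (sval X).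
Proof.
split=> [SX|[s sP]].
  have [|s sP] := in_Sub_joint_mono _ SX.
    by move=> X' Y Z j q /(proj2 hB)[].
  by exists s => W g BW; apply: (sP (exist B W BW)).
apply: (joint_mono_in_Sub (s := s : seq (mor X U))).
- by case: (proj1 hB).
- exact: B_mono_inflation.
by move=> W g; apply: sP (svalP W).
Qed.

Lemma tfree_in_Sub (X : E) : Bperp X -> in_Sub U (tfree_functor hE hAB X).
Proof. by move=> cX; apply/Sub_cogenerated/tfree_cogenerated. Qed.

(** Since [A] has no nonzero morphisms to [X] and [Z], it has none to [Y], so [Y] is isomorphic to
    an object of [B]. Injectivity of [U] extends the family of [X] to [Y]; together with the family
    of [Z] composed with [q] it cogenerates. *)
Lemma Sub_ext (X Z : full B) (Y : E) (j : mor (sval X) Y) (q : mor Y (sval Z)) :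
  ses j q -> in_Sub U X -> in_Sub U Z ->
  exists (Y' : full B) (b : mor (sval Y') Y), in_Sub U Y' /\ is_iso b.
Proof.
move=> sjq /Sub_cogenerated[s sP] /Sub_cogenerated[t tP].
have kj := ses_kernel hE sjq.
have [|Y' [b' [BY' /isoV[b [bb' b'b ib]]]]] := torsionfree_iso hE hAB (X := Y).
  move=> W f AW; have qf := proj1 hAB _ _ (q ∘ f) AW (svalP Z).
  have [g <-] := ker_lift kj qf.
  by rewrite (proj1 hAB _ _ g AW (svalP X)) compm0.
have /choice[e eE] : forall m : mor (sval X) (sval U), exists e, e ∘ j = m.
  by move=> m; apply: (ext1_vanish_extend hE m U_ext1 (svalP Z) sjq).
exists (exist B Y' BY'), b; split=> //; apply/Sub_cogenerated.
exists ([seq e m ∘ b | m <- s] ++ [seq m ∘ q ∘ b | m <- t]) => W g BW g0.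
suff bg0 : b ∘ g = 0 by rewrite -[g]comp1m -b'b -compA bg0 compm0.
have [|h eqh] := ker_lift (f := b ∘ g) kj.
  apply: tP => // m mt; rewrite !compA; apply: g0.
  by rewrite mem_cat; apply/orP; right; apply/mapP; exists m.
rewrite -eqh (sP W h) ?compm0 // => m ms.
rewrite -(eE m) -compA eqh compA; apply: g0.
by rewrite mem_cat; apply/orP; left; apply/mapP; exists m.
Qed.

(** Closure under extensions in [E], up to isomorphism, is what makes [full (in_Sub U)] exact. *)
Lemma Sub_reflects_exact :
  reflects_exact (C := full (in_Sub U)) (D := E)
    (comp_functor (full_incl B) (full_incl (in_Sub U))).
Proof.
split; [by move=> X Y g; exists g | by [] | by [] | |].
- move=> n X W Wsum; have [add _ _ _ _] := proj1 hB.
  have [V Vsum] := add n (fun j => sval (X j)).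
  have SV : in_Sub U V.
    by apply: Sub_dirsum Vsum => j; apply: (svalP (X j)).
  exists (exist _ V SV).
  exact: (dirsum_iso (C := E) (X := fun j => sval (sval (X j))) Vsum Wsum).
move=> X Z Y j q sjq.
have [Y' [b [SY' ib]]] := Sub_ext sjq (svalP X) (svalP Z).
by exists (exist _ Y' SY'), b.
Qed.

(** * The functor from C/[A] to Sub U *)

Let CA : full C -> Prop := fun X => A (full_incl C X).

Definition tfree_Sub : functor (full C) (full (in_Sub U)) :=
  full_lift (F := comp_functor (tfree_functor hE hAB) (full_incl C))
    (fun X => tfree_in_Sub (C_Bperp (svalP X))).

Lemma tfree_Sub_A (X : full C) : CA X -> idm (tfree_Sub X) = 0.
Proof.
move=> AX; apply: (tfree_pi_epi hE (hTF := hAB)).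
have pi0 := proj1 hAB _ _ (tfree_pi hAB (sval X)) AX (tfreeP hAB _).
by rewrite pi0 !compm0.
Qed.

Definition quot_Sub : functor (quot CA) (full (in_Sub U)) :=
  quot_lift tfree_Sub_A.

Lemma quot_Sub_pi (X Y : full C) (f : mor X Y) :
  fmap quot_Sub (fmap (quot_functor CA) f) = tfree_map hE hAB f.
Proof. exact: (quot_lift_pi tfree_Sub_A f). Qed.

Lemma quot_Sub_full : is_full quot_Sub.
Proof.
move=> X Y g.
have [f fE] := tfree_full g (C_Bperp (svalP (X : full C))).
exists (fmap (quot_functor CA) (f : mor (X : full C) (Y : full C))).
by rewrite quot_Sub_pi.
Qed.

(** A morphism killed by the torsion-free quotient factors through tY, which lies in [A] and, being
    projective, also in [C], as the ideal of [full C] requires. *)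
Lemma quot_Sub_faithful : is_faithful quot_Sub.
Proof.
move=> X Y f'; have [f <-] := quot_functor_full f'.
rewrite quot_Sub_pi => /tfree_faithful[h eqh].
rewrite -(fmap0 (quot_functor CA)); apply/quot_piE; rewrite subr0.
pose W : full C :=
  exist C _ (hprojC (tors_projective (X := sval (Y : full C)))).
exists 1%N, (fun=> W), (fun=> tors_inc hAB _), (fun=> h).
split=> [_|]; first exact: torsP.
by rewrite big_ord_recl big_ord0 addr0.
Qed.

Lemma quot_Sub_ess_surjective : ess_surjective quot_Sub.
Proof.
move=> [V SV].
have [X [b [CX ib]]] :=
  cogenerated_tfree (svalP V) (proj1 (Sub_cogenerated V) SV).
by exists (exist C X CX), b.
Qed.

(** Forwards, [tfree_exact] applies to the model in [C] of the sequence. Backwards, [tfree_ext_lift]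
    lifts the image sequence to [E]; its middle term is isomorphic to an object of [C], and fullness
    gives the comparison with [Y]. *)
Lemma quot_Sub_ses (X Y Z : quot CA) (f : mor X Y) (q : mor Y Z) :
  ses f q <-> ses (fmap quot_Sub f) (fmap quot_Sub q).
Proof.
split=> [|sfq].
  move=> [X' [Y' [Z' [f' [q' [a [b [c [[sf'q' ia ib ic] [eqf eqq]]]]]]]]]].
  have sL := tfree_exact sf'q' (C_Bperp (svalP X')).
  have iE (V W : full (in_Sub U)) (g : mor V W) : is_iso g ->
      @is_iso _ E (sval (sval V)) (sval (sval W)) g by [].
  apply: (ses_iso hE (iE _ _ _ (fmap_iso quot_Sub ia))
    (iE _ _ _ (fmap_iso quot_Sub ib)) (iE _ _ _ (fmap_iso quot_Sub ic)) _ _ sL).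
    have := congr1 (fmap quot_Sub) eqf.
    by rewrite !fmapM quot_Sub_pi.
  have := congr1 (fmap quot_Sub) eqq.
  by rewrite !fmapM quot_Sub_pi.
have cogC (V : full C) := C_Bperp (svalP V).
have [Y1 [f1 [q1 [b [s1 cY1 ib bf qb]]]]] :=
  tfree_ext_lift sfq (cogC X) (cogC Z) (tfreeP hAB (sval (Y : full C))).
have [Y2 [d [CY2 /isoV[d' [d'd dd' id']]]]] := Bperp_iso cY1.
pose Y' : full C := exist C Y2 CY2.
pose L := tfree_functor hE hAB.
have [b0 b0E] := quot_Sub_full (X := Y') (Y := Y) (b ∘ tfree_map hE hAB d').
have Finj V W := @faithful_inj _ _ _ quot_Sub V W quot_Sub_faithful.
exists X, Y', Z, (d ∘ f1), (q1 ∘ d'), (idm X), b0, (idm Z); split.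
  split; try exact: iso1; first exact: ses_iso_mid.
  apply: (ff_iso quot_Sub_full quot_Sub_faithful); rewrite b0E.
  by apply: (isoM (C := E)) => //; apply: (fmap_iso L id').
split; apply: Finj; rewrite ?compm1 ?comp1m fmapM quot_Sub_pi ?fmapM b0E.
  apply: (etrans _ bf); rewrite -[in RHS](comp1m f1) -d'd -(compA d').
  by rewrite (tfree_mapM hE hAB d') compA.
by apply: (etrans (tfree_mapM hE hAB q1 d')); rewrite -qb -compA.
Qed.

Lemma quot_Sub_exact_equivalence : is_exact_equivalence quot_Sub.
Proof.
apply: ff_exact_equivalence.
- exact: reflects_exact_exact hE Sub_reflects_exact.
- exact: quot_Sub_full.
- exact: quot_Sub_faithful.
- exact: quot_Sub_ess_surjective.
exact: quot_Sub_ses.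
Qed.

End Main.
Theorem theorem4 (k : fieldType) (E : seqCat k)
    (hE : is_exact E) (hKS : krull_schmidt E) (hfin : hom_finite E)
    (A B C : E -> Prop)
    (hAB : torsion_pair A B) (hBC : torsion_pair B C)
    (hproj : enough_projectives E)
    (hprojC : forall Q : E, projective Q -> C Q)
    (P : E) (hP : projective P) (hPC : injective_in C P)
    (hA : forall X : E, A X <-> in_add P X)
    (hB : abelian_compatible B)
    (CP : E) (U : full B) (i : mor P CP) (p : mor CP (full_incl B U))
    (hU : is_U_sequence C i p) :
  injective_in B (full_incl B U) /\
  exists F : functor (quot (fun X : full C => A (full_incl C X)))
                     (full (in_Sub U)),
    is_exact_equivalence F /\
    exists L : functor E (full B),
      is_left_adjoint L (full_incl B) /\
      nat_isomorphic
        (comp_functor (full_incl (in_Sub U))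
           (comp_functor F
              (quot_functor (fun X : full C => A (full_incl C X)))))
        (comp_functor L (full_incl C)).
Proof.
split; first by split; [exact: svalP | exact: U_ext1 hU].
pose F := quot_Sub hE hAB hBC hA hB hU.
exists F; split; first exact: quot_Sub_exact_equivalence.
exists (tfree_functor hE hAB); split; first exact: tfree_left_adjoint.
(* Identities suffice: on objects, both composites are the torsion-free quotient by definition. *)
exists (fun X => idm _); split=> [X|X Y f]; first exact: iso1.
by rewrite compm1 comp1m; apply: quot_Sub_pi.
Qed.
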